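(* Let $E_{0}\subset\mathbb{R}^{3}$ be a bounded open domain whose boundary $N_0=\partial E_{0}$ is a connected $C^{\infty}$ hypersurface with $H>0$. Suppose the maximal solution $\{N_{t}\}_{0\le t<T_{\max}}$ of Inverse Mean Curvature Flow starting from $N_{0}$ satisfies $T_{\max}=+\infty$ and $N_{t}$ is embedded for each $t\in[0,+\infty)$. Then for any Jordan curve $\gamma\subset\overline{E}_{0}$ and any stable immersed minimal disk $D$ with $\partial D=\gamma$, we have $D\subset E_{0}$.
   Context: $H$ is the mean curvature (sum of principal curvatures) with respect to the outward unit normal $\nu$, positive on round spheres. Inverse Mean Curvature Flow: with $N$ a closed surface and $F_0:N\to\mathbb{R}^3$ an embedding with image $N_0$, it is the unique maximal smooth family of immersions $F:N\times[0,T_{\max})\to\mathbb{R}^3$ with $F(\cdot,0)=F_0$, $H>0$ and $\frac{\partial F}{\partial t}(x,t)=\frac1H\nu(x,t)$; $N_t=F_t(N)$. An immersed disk $D$ with boundary $\gamma$ is understood as the open disk, not including its boundary curve $\gamma$. A minimal disk is stable if its second variation of area is nonnegative for compactly supported variations. *)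

(* Defs.v *)
From HB Require Import structures.
From mathcomp Require Import all_boot all_order all_algebra.
From mathcomp Require Import all_classical all_reals all_analysis.

Set Implicit Arguments.
Unset Strict Implicit.
Unset Printing Implicit Defensive.

Import Order.TTheory GRing.Theory Num.Theory.
Import numFieldNormedType.Exports.

Local Open Scope classical_set_scope.
Local Open Scope ring_scope.

Section Smooth.
Context {R : realType} {V W : normedModType R}.

(* C^k regularity on an open set [U], through iterated directional derivatives. *)
Fixpoint Ck_on (k : nat) (U : set V) (f : V -> W) : Prop :=
  match k with
  | 0 => forall x, U x -> {for x, continuous f}
  | k'.+1 => (forall x, U x -> differentiable f x) /\
             (forall v : V, Ck_on k' U (fun x => 'D_v f x))
  end.

Definition smooth_on (U : set V) (f : V -> W) : Prop :=
  forall k, Ck_on k U f.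

(* Smoothness on an arbitrary set [A] (here U x [0, T)): local existence of
   smooth extensions to open sets. *)
Definition smooth_within (A : set V) (f : V -> W) : Prop :=
  forall p, A p -> exists (U : set V) (g : V -> W),
    [/\ open U, U p, smooth_on U g & forall q, U q -> A q -> g q = f q].

End Smooth.

Section Surfaces.
Context {R : realType}.
Local Notation E2 := 'rV[R]_2.
Local Notation E3 := 'rV[R]_3.

(* The library norm on row vectors is the sup norm; Euclidean geometry is
   expressed through this inner product. *)
Definition dot n (u v : 'rV[R]_n) : R := \sum_(i < n) u 0 i * v 0 i.

Definition frontier (E : set E3) : set E3 := closure E `\` interior E.

Definition partial (i : 'I_2) (X : E2 -> E3) : E2 -> E3 :=
  fun u => 'D_(delta_mx 0 i) X u.

Definition immersion_on (U : set E2) (X : E2 -> E3) : Prop :=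
  smooth_on U X /\ forall u, U u -> injective ('d X u).

Definition unit_normal (X : E2 -> E3) (u : E2) (n : E3) : Prop :=
  dot n n = 1 /\ forall v, dot n ('d X u v) = 0.

Definition first_form (X : E2 -> E3) (u : E2) : 'M[R]_2 :=
  \matrix_(i, j) dot (partial i X u) (partial j X u).

(* The sign is chosen so that the unit sphere with its outward normal has
   second form equal to its first form, hence mean curvature 2. *)
Definition second_form (X : E2 -> E3) (u : E2) (n : E3) : 'M[R]_2 :=
  \matrix_(i, j) - dot n (partial i (partial j X) u).

(* The principal curvatures are the eigenvalues of the shape operator, whose
   matrix in the basis of coordinate vectors is I^-1 II; H is their sum. *)
Definition shape_operator (X : E2 -> E3) (u : E2) (n : E3) : 'M[R]_2 :=
  invmx (first_form X u) *m second_form X u n.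

Definition mean_curvature (X : E2 -> E3) (u : E2) (n : E3) : R :=
  \tr (shape_operator X u n).

Definition local_parametrization (S : set E3) (U : set E2) (X : E2 -> E3) :
    Prop :=
  [/\ open U, immersion_on U X, set_inj U X &
      forall V : set E2, open V -> V `<=` U ->
        exists2 O : set E3, open O & X @` V = S `&` O].

Definition smooth_hypersurface (S : set E3) : Prop :=
  forall p, S p -> exists (U : set E2) (X : E2 -> E3),
    local_parametrization S U X /\ (X @` U) p.

(* [n] points out of [E] at the boundary point [p]; for [n] a unit normal to a
   smooth boundary this singles out the outward one. *)
Definition points_outward (E : set E3) (p n : E3) : Prop :=
  \forall s \near 0^'+, E (p - s *: n) /\ ~ closure E (p + s *: n).

Definition mean_convex_boundary (E : set E3) : Prop :=
  forall (U : set E2) (X : E2 -> E3),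
    local_parametrization (frontier E) U X ->
    forall u n, U u -> unit_normal X u n -> points_outward E (X u) n ->
    0 < mean_curvature X u n.

(* Abstract smooth closed surfaces: an atlas of pairs (U, phi), with [phi] a
   homeomorphism from the open set [U] of the plane onto an open subset of the
   surface. *)
Record closedSurface := ClosedSurface {
  surface_top :> topologicalType;
  atlas : set (set E2 * (E2 -> surface_top));
  surface_hausdorff : hausdorff_space surface_top;
  surface_compact : compact [set: surface_top];
  surface_chart : forall c, atlas c ->
      [/\ open c.1, set_inj c.1 c.2,
          forall u, c.1 u -> {for u, continuous c.2} &
          forall V : set E2, open V -> V `<=` c.1 -> open (c.2 @` V)];
  surface_cover : forall x, exists2 c, atlas c & (c.2 @` c.1) x;
  surface_transition : forall c c', atlas c -> atlas c' -> forall tau : E2 -> E2,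
      (forall u, c.1 u -> (c'.2 @` c'.1) (c.2 u) ->
         c'.1 (tau u) /\ c'.2 (tau u) = c.2 u) ->
      smooth_on [set u | c.1 u /\ (c'.2 @` c'.1) (c.2 u)] tau
}.

Definition immersion (N : closedSurface) (G : N -> E3) : Prop :=
  forall c, atlas c -> immersion_on c.1 (G \o c.2).

(* As [N] is compact, an injective immersion is a homeomorphism onto its
   image. *)
Definition embedding (N : closedSurface) (G : N -> E3) : Prop :=
  immersion G /\ injective G.

Definition time_interval (T : \bar R) : set R :=
  [set t | 0 <= t /\ (t%:E < T)%E].

(* Smooth solution on [0, T) of dF/dt = nu / H with H > 0, starting from [F0]
   whose image bounds [E0].  As the F(., t) are only immersions, the outward
   unit normal nu is the continuous unit normal field which at time 0 points
   out of [E0].  The time derivative is relative to [0, T), hence one-sided at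
   t = 0. *)
Definition IMCF (E0 : set E3) (N : closedSurface) (F0 : N -> E3)
    (T : \bar R) (F : N -> R -> E3) : Prop :=
  [/\ (0 < T)%E,
      forall x, F x 0 = F0 x,
      forall c, atlas c ->
        smooth_within (c.1 `*` time_interval T)
          (fun p : E2 * R => F (c.2 p.1) p.2),
      forall t, time_interval T t -> immersion (F ^~ t) &
      exists nu : N -> R -> E3,
        [/\ {within [set: N] `*` time_interval T,
              continuous (fun p : N * R => nu p.1 p.2)},
            forall x, points_outward E0 (F0 x) (nu x 0) &
            forall c u t, atlas c -> c.1 u -> time_interval T t ->
              let X := fun v => F (c.2 v) t in
              let x := c.2 u in
              let H := mean_curvature X u (nu x t) in
              [/\ unit_normal X u (nu x t), 0 < H &
                  (s - t)^-1 *: (F x s - F x t)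
                    @[s --> within (time_interval T) t^'] -->
                  H^-1 *: nu x t]]].

Definition maximal_IMCF (E0 : set E3) (N : closedSurface) (F0 : N -> E3)
    (T : \bar R) (F : N -> R -> E3) : Prop :=
  IMCF E0 F0 T F /\
  forall (T' : \bar R) (F' : N -> R -> E3), IMCF E0 F0 T' F' ->
    (forall x t, time_interval T t -> time_interval T' t -> F' x t = F x t) ->
    (T' <= T)%E.

Definition unit_circle : set E2 := [set u | dot u u = 1].
Definition unit_disk : set E2 := [set u | dot u u < 1].
Definition closed_disk (r : R) : set E2 := [set u | dot u u <= r ^+ 2].

Definition jordan_curve (gamma : set E3) : Prop :=
  exists c : E2 -> E3,
    [/\ {within unit_circle, continuous c}, set_inj unit_circle c &
        c @` unit_circle = gamma].

Definition plane_point (p : R * R) : E2 :=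
  \row_(i < 2) (if i == ord0 then p.1 else p.2).

Definition area (X : E2 -> E3) (r : R) : R :=
  Rintegral (lebesgue_measure \x lebesgue_measure)%E
    (plane_point @^-1` closed_disk r)
    (fun p => Num.sqrt (\det (first_form X (plane_point p)))).

(* Variation of [f] on the open unit disk, for parameters in (-e, e), supported
   in the closed disk of radius [r] < 1. *)
Definition compact_variation (f : E2 -> E3) (r e : R) (Phi : R -> E2 -> E3) :
    Prop :=
  [/\ 0 < r < 1, 0 < e,
      smooth_on ([set` `]- e, e[] `*` unit_disk) (fun p : R * E2 => Phi p.1 p.2),
      forall u, unit_disk u -> Phi 0 u = f u &
      forall s u, s \in `]- e, e[ -> unit_disk u -> ~ closed_disk r u ->
        Phi s u = f u].

Definition minimal (f : E2 -> E3) : Prop :=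
  forall u n, unit_disk u -> unit_normal f u n -> mean_curvature f u n = 0.

Definition stable (f : E2 -> E3) : Prop :=
  forall r e Phi, compact_variation f r e Phi ->
    0 <= derive1n 2 (fun s : R => area (Phi s) r) 0.

(* [D] is the image of the open disk, so it does not include its boundary
   curve, which [f] parametrizes homeomorphically on the unit circle. *)
Definition stable_minimal_disk (D gamma : set E3) : Prop :=
  exists f : E2 -> E3,
    [/\ {within closed_disk 1, continuous f},
        immersion_on unit_disk f,
        set_inj unit_circle f /\ f @` unit_circle = gamma,
        minimal f /\ stable f &
        D = f @` unit_disk].

End Surfaces.

Arguments closedSurface R : clear implicits.

(* Main.v *)
Require Import Defs.
From HB Require Import structures.
From mathcomp Require Import all_boot all_order all_algebra.
From mathcomp Require Import all_classical all_reals all_analysis.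
From mathcomp Require Import ring lra.

Set Implicit Arguments.
Unset Strict Implicit.
Unset Printing Implicit Defensive.

Import Order.TTheory GRing.Theory Num.Theory.
Import numFieldNormedType.Exports.

Local Open Scope classical_set_scope.
Local Open Scope ring_scope.

(** Write N_t for the image of [F ^~ t], and W_t for the union of E0 with all the
N_s, s < t ([swept]); adding N_t itself gives [hull].  The surfaces N_t are the
leaves of a foliation of the complement of E0, each of positive mean curvature
with respect to the normal that points away from E0, and the disk is excluded by
the leaf that it meets last.

Suppose that the disk has a point outside E0, and let t be the last time at
which N_t meets the image K of the closed disk.  Then K lies in W_t or on N_t,
and N_t is met at an interior point of the disk: if t > 0, because the boundary
curve lies in the closure of E0, which W_t contains and N_t avoids; if t = 0,
because the given point outside E0 is then on N_0.  At such a point the disk is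
tangent to N_t and lies behind it, so that its mean curvature, which is 0, is at
least that of N_t, which is positive ([no_interior_touching]).

For this to make sense the leaves must be disjoint and run off to infinity.

Disjointness ([swept_disjoint]) is proved by continuous induction on t.  Its
main ingredient is that W_t is open ([open_swept]).  Let p be close to a point of
N_s; minimise the distance from p to F over N x [a, b], with a < s < b.  The
differential of F is onto at every point of space-time, as it maps the time
direction to a nonzero normal vector; hence a positive minimum is attained only
at times a or b, which is impossible when p is close to N_s, and so p is itself
in the image.

The leaves run off to infinity because round spheres are barriers
([expanding_barrier]).  Let p be a point of E0 and let rho be the distance from p
to N_t.  At a nearest point the surface is outside a ball of radius rho which it
touches, so H <= 2 / rho there and the surface recedes at speed at least rho / 2.
The nearest point is approached from W_t because a ball around p that N_t does
not meet cannot leave W_t, so it is the outward normal that points away from p.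

That a set lies behind N_t near a point is expressed with cones: given any
aperture, the small cones around the normal direction at nearby points of N_t lie
outside [hull t] ([cone_outside_hull]).  A curve that leaves N_t to first or
second order on the side of the normal enters such a cone
([higher_order_in_cone]); this yields tangency and then the comparison of second
derivatives which [mean_curvature_comparison] turns into one of mean
curvatures. *)

(** * The Euclidean inner product and the sup norm *)

Section InnerProduct.
Context {R : realType} {n : nat}.
Implicit Types u v w : 'rV[R]_n.

Lemma dotC u v : dot u v = dot v u.
Proof. by apply: eq_bigr => i _; rewrite mulrC. Qed.

Lemma dotDl u v w : dot (u + v) w = dot u w + dot v w.
Proof. by rewrite -big_split; apply: eq_bigr => i _; rewrite mxE mulrDl. Qed.

Lemma dotZl (a : R) u v : dot (a *: u) v = a * dot u v.
Proof. by rewrite mulr_sumr; apply: eq_bigr => i _; rewrite mxE mulrA. Qed.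

Lemma dotDr u v w : dot u (v + w) = dot u v + dot u w.
Proof. by rewrite dotC dotDl !(dotC u). Qed.

Lemma dotZr (a : R) u v : dot u (a *: v) = a * dot u v.
Proof. by rewrite dotC dotZl dotC. Qed.

Lemma dotNr u v : dot u (- v) = - dot u v.
Proof. by rewrite -scaleN1r dotZr mulN1r. Qed.

Lemma dotBr u v w : dot u (v - w) = dot u v - dot u w.
Proof. by rewrite dotDr dotNr. Qed.

Lemma dot_sqrD u v : dot (u + v) (u + v) = dot u u + 2 * dot u v + dot v v.
Proof. by rewrite dotDl !dotDr (dotC v u); ring. Qed.

Lemma dot0l v : dot 0 v = 0.
Proof. by rewrite -(scale0r 0) dotZl mul0r. Qed.

Lemma dot_ge0 u : 0 <= dot u u.
Proof. by apply: sumr_ge0 => i _; rewrite -expr2 sqr_ge0. Qed.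

Lemma dot_eq0 u : dot u u = 0 -> u = 0.
Proof.
move/eqP; rewrite psumr_eq0 => [/allP h|i _]; last by rewrite -expr2 sqr_ge0.
apply/rowP => i; have := h i (mem_index_enum i).
by rewrite mxE mulf_eq0 orbb => /eqP.
Qed.

Lemma dot_gt0 u : u != 0 -> 0 < dot u u.
Proof.
move=> u0; rewrite lt_neqAle dot_ge0 andbT eq_sym.
by apply: contra u0 => /eqP /dot_eq0 ->.
Qed.

Lemma coord_le_norm u i : `|u 0 i| <= `|u|.
Proof. by rewrite [leRHS]/Num.Def.normr/= mx_normrE (le_bigmax _ _ (0, i)). Qed.

Lemma norm_le_coord u (e : R) : 0 <= e -> (forall i, `|u 0 i| <= e) -> `|u| <= e.
Proof.
move=> e0 h; rewrite /Num.Def.normr/= mx_normrE bigmax_le// => -[i j] _ /=.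
by rewrite ord1.
Qed.

(** Estimates are done in the sup norm, which the topology is built on; this and
[norm_sqr_le_dot] compare it with the inner product. *)
Lemma dot_norm_le u v : `|dot u v| <= n%:R * `|u| * `|v|.
Proof.
apply: le_trans (ler_norm_sum _ _ _) _.
apply: (@le_trans _ _ (\sum_(i < n) `|u| * `|v|)).
  by apply: ler_sum => i _; rewrite normrM ler_pM ?coord_le_norm.
by rewrite sumr_const card_ord -mulrA mulr_natl.
Qed.

Lemma norm_sqr_le_dot u : `|u| ^+ 2 <= dot u u.
Proof.
rewrite -(sqr_sqrtr (dot_ge0 u)) lerXn2r ?nnegrE ?sqrtr_ge0//.
apply: norm_le_coord => [|i]; first exact: sqrtr_ge0.
rewrite -sqrtr_sqr ler_wsqrtr// /dot (bigD1 i)//= -expr2 lerDl.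
by apply: sumr_ge0 => j _; rewrite -expr2 sqr_ge0.
Qed.

Lemma continuous_dot (T : topologicalType) (f g : T -> 'rV[R]_n) (x : T) :
  {for x, continuous f} -> {for x, continuous g} ->
  {for x, continuous (fun y => dot (f y) (g y))}.
Proof.
move=> cf cg; rewrite /dot /continuous_at.
apply: cvg_big => [|i _]; first exact: add_continuous.
have c (h : T -> 'rV[R]_n) : {for x, continuous h} ->
    (fun y => h y 0 i) @ x --> h x 0 i.
    move=> ch; apply: (@continuous_comp _ _ _ h (fun N : 'rV[R]_n => N 0 i)) => //.
    exact: coord_continuous.
exact: cvgM (c _ cf) (c _ cg).
Qed.

End InnerProduct.

(** * Segments that avoid a frontier *)

Section Segments.
Context {R : realType}.

(** On a set that avoids the frontier of G, the interior and the closure of G cut out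
the same subset, which is therefore open and closed. *)
Lemma connected_sub_frontier (A G : set 'rV[R]_3) :
  connected A -> A `&` frontier G = set0 -> A `&` G !=set0 -> A `<=` G.
Proof.
move=> cA AG [x [Ax Gx]].
have AI y : A y -> closure G y -> interior G y.
  move=> Ay Gy; apply: contrapT => nG.
  by have : (A `&` frontier G) y by []; rewrite AG.
have -> : A = A `&` G.
  symmetry; apply: cA; first by exists x.
    exists (interior G); first exact: open_interior.
    apply/seteqP; split=> [y [Ay Gy]|y [Ay Gy]]; split=> //.
      by apply: AI => //; exact: subset_closure.
    exact: interior_subset.
  exists (closure G); first exact: closed_closure.
  apply/seteqP; split=> [y [Ay Gy]|y [Ay Gy]]; split=> //.
    exact: subset_closure.
  by apply: interior_subset; apply: AI.
by move=> y [].
Qed.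

Lemma connected_out_closure (A G : set 'rV[R]_3) (z : 'rV[R]_3) :
  connected A -> A `&` frontier G = set0 -> A z -> ~ closure G z ->
  A `&` closure G = set0.
Proof.
move=> cA AG Az nG; rewrite -subset0 => x [Ax Gx].
apply: nG; apply: subset_closure.
apply: (connected_sub_frontier cA AG _ Az); exists x; split=> //.
apply: contrapT => nGx; have : (A `&` frontier G) x; last by rewrite AG.
by split=> //; split=> // /interior_subset.
Qed.

Definition segment (p z : 'rV[R]_3) : set 'rV[R]_3 :=
  (fun s : R => p + s *: (z - p)) @` [set s | 0 <= s <= 1].

Lemma segment_rV_connected p z : connected (segment p z).
Proof.
apply: connected_continuous_connected.
  have -> : [set s : R | 0 <= s <= 1] = [set` `[0, 1]].
    by apply/seteqP; split=> s /=; rewrite in_itv.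
  exact: segment_connected.
apply: continuous_subspaceT => s.
by apply: cvgD; [exact: cvg_cst | exact: scalel_continuous].
Qed.

Lemma segment_left p z : segment p z p.
Proof. by exists 0; rewrite /= ?lexx ?ler01// scale0r addr0. Qed.

Lemma segment_right p z : segment p z z.
Proof. by exists 1; rewrite /= ?lexx ?ler01// scale1r addrC subrK. Qed.

End Segments.

(** * Differentiability *)

Section Lines.
Context {R : realType} {V : normedModType R}.

Lemma is_derive_line (W : normedModType R) (f : V -> W) (x v : V) (s : R) :
  derivable f (x + s *: v) v ->
  is_derive s 1 (fun r => f (x + r *: v)) ('D_v f (x + s *: v)).
Proof.
move=> df.
have E : (fun h : R => h^-1 *: (((fun r => f (x + r *: v)) \o shift s) (h *: 1)
            - f (x + s *: v))) =
         (fun h => h^-1 *: ((f \o shift (x + s *: v)) (h *: v) - f (x + s *: v))).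
  apply/funext => h /=; congr (_ *: (f _ - _)).
  by rewrite [h *: 1]mulr1 scalerDl addrCA.
split; first by rewrite /derivable E.
by rewrite /derive E.
Qed.

Lemma is_derive_coord n (f : V -> 'rV[R]_n) (x v : V) (df : 'rV[R]_n) i :
  is_derive x v f df -> is_derive x v (fun y => f y 0 i) (df 0 i).
Proof.
move=> [d <-]; split; first exact: (derivable_mxP _ _ _).1 d 0 i.
by rewrite derive_mx// mxE.
Qed.

End Lines.

Section StrictDifferentiability.
Context {R : realType}.
Local Notation V := ('rV[R]_2 * R)%type.

Lemma decompose_prod (v : V) :
  v = v.1 0 0 *: (delta_mx 0 0, 0) + v.1 0 1 *: (delta_mx 0 1, 0) +
      v.2 *: (0, 1).
Proof.
case: v => w h; congr pair; rewrite /= ?scaler0 ?addr0 ?add0r.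
  rewrite {1}(row_sum_delta w) big_ord_recl big_ord1.
  by congr (_ + w 0 _ *: delta_mx 0 _); apply/val_inj.
by rewrite [h *: 1]mulr1.
Qed.

Lemma linear_decompose_prod (W : lmodType R) (L : {linear V -> W}) (v : V) :
  L v = v.1 0 0 *: L (delta_mx 0 0, 0) + v.1 0 1 *: L (delta_mx 0 1, 0) +
        v.2 *: L (0, 1).
Proof. by rewrite {1}(decompose_prod v) !linearD !linearZ. Qed.

(** A linear map on the product is a combination of its values on three vectors with
coefficients bounded by the norm of the argument: closeness on these vectors is
closeness in operator norm. *)
Lemma linear_close_basis (W : normedModType R) (L L' : {linear V -> W}) (e : R)
    (v : V) :
  `|L (delta_mx 0 0, 0) - L' (delta_mx 0 0, 0)| <= e / 3 ->
  `|L (delta_mx 0 1, 0) - L' (delta_mx 0 1, 0)| <= e / 3 ->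
  `|L (0, 1) - L' (0, 1)| <= e / 3 ->
  `|L v - L' v| <= e * `|v|.
Proof.
move=> h0 h1 h2; rewrite (linear_decompose_prod L) (linear_decompose_prod L').
move: h0 h1 h2; move: (L (delta_mx 0 0, 0)) (L' (delta_mx 0 0, 0)).
move: (L (delta_mx 0 1, 0)) (L' (delta_mx 0 1, 0)) => B B' A A'.
move: (L (0, 1)) (L' (0, 1)) => C C' h0 h1 h2.
have -> : v.1 0 0 *: A + v.1 0 1 *: B + v.2 *: C -
    (v.1 0 0 *: A' + v.1 0 1 *: B' + v.2 *: C') =
    v.1 0 0 *: (A - A') + v.1 0 1 *: (B - B') + v.2 *: (C - C').
  by rewrite !scalerBr (addrACA (_ *: A)) -opprD addrACA -opprD.
have n1 : `|v.1| <= `|v| by rewrite prod_normE le_max lexx.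
have n2 : `|v.2| <= `|v| by rewrite prod_normE le_max lexx orbT.
have -> : e * `|v| = `|v| * (e / 3) + `|v| * (e / 3) + `|v| * (e / 3) by field.
apply: le_trans (ler_normD _ _) _; apply: lerD; last by rewrite normrZ ler_pM.
apply: le_trans (ler_normD _ _) _; apply: lerD; rewrite normrZ ler_pM//;
  exact: le_trans (coord_le_norm _ _) n1.
Qed.

(** Strict differentiability: along the segment from b to a, the mean value theorem
expresses each coordinate of the increment by a differential at an intermediate
point, which is uniformly close to the differential at p. *)
Lemma strict_differentiability (U : set V) (g : V -> 'rV[R]_3) (p : V) :
  open U -> smooth_on U g -> U p -> forall e, 0 < e ->
  exists2 d, 0 < d & forall a b, `|a - p| < d -> `|b - p| < d ->
    `|g a - g b - 'd g p (a - b)| <= e * `|a - b|.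
Proof.
move=> oU sg Up e e0.
have dg q : U q -> differentiable g q by move: (sg 1%N) => [+ _]; exact.
have cD v : {for p, continuous (fun q => 'D_v g q)}.
  by case: (sg 1%N) => _ /(_ v) /(_ _ Up).
pose b0 : V := (delta_mx 0 0, 0); pose b1 : V := (delta_mx 0 1, 0).
pose b2 : V := (0, 1).
have e3 : 0 < e / 3 by rewrite divr_gt0.
have cl v : \forall q \near p, `|'D_v g q - 'D_v g p| < e / 3.
  by have /cvgrPdist_lt/(_ _ e3) := cD v; under eq_near do rewrite distrC.
have : \forall q \near p, [/\ U q, `|'D_b0 g q - 'D_b0 g p| < e / 3,
   `|'D_b1 g q - 'D_b1 g p| < e / 3 & `|'D_b2 g q - 'D_b2 g p| < e / 3].
  have nU : \forall q \near p, U q by exact: open_nbhs_nbhs.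
  apply: filterS (filterI (filterI nU (cl b0)) (filterI (cl b1) (cl b2))).
  by move=> q [[? ?] [? ?]]; split.
move=> /nbhs_ballP[d /= d0 hd]; exists d => // a b ap bp.
have close q v : ball p d q -> `|'d g q v - 'd g p v| <= e * `|v|.
  have transfer (x y x' y' : 'rV[R]_3) (k : R) :
    x = x' -> y = y' -> `|x - y| < k -> `|x' - y'| <= k by move=> <- <- /ltW.
  move=> /hd[Uq h0 h1 h2]; apply: linear_close_basis.
  - exact: (transfer _ _ _ _ _ (deriveE b0 (dg _ Uq)) (deriveE b0 (dg _ Up)) h0).
  - exact: (transfer _ _ _ _ _ (deriveE b1 (dg _ Uq)) (deriveE b1 (dg _ Up)) h1).
  - exact: (transfer _ _ _ _ _ (deriveE b2 (dg _ Uq)) (deriveE b2 (dg _ Up)) h2).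
have seg s : 0 <= s <= 1 -> ball p d (b + s *: (a - b)).
  move=> /andP[s0 s1]; rewrite -ball_normE/= distrC.
  have -> : b + s *: (a - b) - p = (1 - s) *: (b - p) + s *: (a - p).
    have -> : a - b = (a - p) - (b - p) by rewrite opprB addrA subrK.
    rewrite [s *: (_ - (b - p))]scalerBr scalerBl scale1r.
    by move: (s *: (a - p)) (s *: (b - p)) => x y; rewrite addrAC [x - y]addrC addrA.
  apply: le_lt_trans (ler_normD _ _) _; rewrite !normrZ.
  rewrite (ger0_norm s0) ger0_norm ?subr_ge0//.
  set x := `|b - p| in bp *; set y := `|a - p| in ap *.
  case: (ltrP 0 s) => [s0'|s0']; last by nra.
  by nra.
apply: norm_le_coord => [|i]; first by rewrite mulr_ge0// ltW.
pose h (s : R) : R := g (b + s *: (a - b)) 0 i.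
pose dh (s : R) : R := 'D_(a - b) g (b + s *: (a - b)) 0 i.
have isd (s : R) : 0 <= s <= 1 -> is_derive s 1 h (dh s).
  move=> hs; apply: is_derive_coord; apply: is_derive_line.
  by apply: diff_derivable; apply: dg; have [] := hd _ (seg _ hs).
have [||c cI hc] := @MVT R h dh 0 1 ltr01.
- by move=> s; rewrite in_itv/= => /andP[/ltW s0 /ltW s1]; apply: isd; rewrite s0.
- apply: derivable_within_continuous => s; rewrite in_itv/= => hs.
  by have [] := isd _ hs.
have c01 : 0 <= c <= 1 by move: cI; rewrite in_itv/= => /andP[/ltW -> /ltW ->].
have E : dh c = 'd g (b + c *: (a - b)) (a - b) 0 i.
  have [Uc _ _ _] := hd _ (seg _ c01).
  exact: (congr1 (fun u : 'rV[R]_3 => u 0 i) (deriveE (a - b) (dg _ Uc))).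
have {}hc : (g a - g b) 0 i = dh c.
  rewrite !mxE; move: hc; rewrite /h scale1r scale0r addr0 subr0 mulr1.
  by rewrite [b + _]addrC subrK.
have eqcoord (x y z : 'rV[R]_3) : x 0 i = y 0 i -> `|(x - z) 0 i| = `|(y - z) 0 i|.
  by rewrite !mxE => ->.
rewrite (eqcoord _ _ _ (etrans hc E)).
exact: le_trans (coord_le_norm _ i) (close _ (a - b) (seg _ c01)).
Qed.

End StrictDifferentiability.

Section SecondOrder.
Context {R : realType}.
Local Notation E2 := 'rV[R]_2.
Local Notation E3 := 'rV[R]_3.

(** A form of the mean value theorem that does not depend on the sign of s. *)
Lemma mean_value_from0 (h dh : R -> R) (s : R) :
  (forall r : R, `|r| <= `|s| -> is_derive r (1 : R) h (dh r)) ->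
  exists2 c, `|c| <= `|s| & h s - h 0 = dh c * s.
Proof.
move=> hd; have [s0|s0] := leP 0 s.
  have sub (r : R) : 0 <= r <= s -> is_derive r (1 : R) h (dh r).
    by move=> /andP[r0 rs]; apply: hd; rewrite !ger0_norm.
  have [||c] := @MVT_segment R h dh 0 s s0.
  - by move=> r; rewrite in_itv/= => /andP[/ltW r0 /ltW rs]; apply: sub; rewrite r0.
  - apply: derivable_within_continuous => r; rewrite in_itv/= => rs.
    by have [] := sub r rs.
  - rewrite in_itv/= subr0 => /andP[c0 cs] E; exists c => //.
    by rewrite !ger0_norm.
have sub (r : R) : s <= r <= 0 -> is_derive r (1 : R) h (dh r).
  by move=> /andP[sr r0]; apply: hd; rewrite !ler0_norm ?lerN2// ltW.
have [||c] := @MVT_segment R h dh s 0 (ltW s0).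
- by move=> r; rewrite in_itv/= => /andP[/ltW r0 /ltW rs]; apply: sub; rewrite r0.
- apply: derivable_within_continuous => r; rewrite in_itv/= => rs.
  by have [] := sub r rs.
- rewrite in_itv/= sub0r => /andP[c0 cs] E; exists c => //.
    by rewrite !ler0_norm ?lerN2// ltW.
  by rewrite -opprB E mulrN opprK.
Qed.

(** The mean value theorem, applied to h minus its expansion: the derivative of the
difference is o(s). *)
Lemma taylor2 (h dh : R -> R) (c e : R) :
  (\forall s \near (0 : R), is_derive (s : R) (1 : R) h (dh s)) ->
  is_derive (0 : R) (1 : R) dh c -> 0 < e ->
  \forall s \near (0 : R), `|h s - h 0 - s * dh 0 - s ^+ 2 / 2 * c| <= e * s ^+ 2.
Proof.
move=> hd [/derivable_nbhs dd cE] e0.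
have near1 : \forall s \near (0 : R), `|dh s - dh 0 - s * c| <= e * `|s|.
  have /eqaddoP/(_ _ e0) := dd.
  apply: filterS => s; rewrite cE.
  have -> : ((fun r : R => (dh \o shift 0) r%:A) - (cst (dh 0) + *:%R^~ c)) s
      = dh (s * 1 + 0) - (dh 0 + s * c) by [].
  by rewrite mulr1 addr0 opprD addrA.
have : nbhs (0 : R) [set s : R | is_derive s (1 : R) h (dh s) /\
    `|dh s - dh 0 - s * c| <= e * `|s|] by exact: filterI.
move=> /nbhs_ballP[d /= d0 hball].
apply/nbhs_ballP; exists d => //= s; rewrite -ball_normE/= sub0r normrN => sd.
have inball (r : R) : `|r| <= `|s| -> ball 0 d r.
  by move=> rs; rewrite -ball_normE/= sub0r normrN (le_lt_trans rs).
pose k (r : R) := h r - r * dh 0 - r ^+ 2 / 2 * c.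
pose dk (r : R) := dh r - dh 0 - r * c.
have kd (r : R) : `|r| <= `|s| -> is_derive r (1 : R) k (dk r).
  move=> rs; have [hr _] := hball _ (inball _ rs).
  rewrite /k /dk; apply: is_derive_eq.
  by rewrite /GRing.scale /=; field.
have [x xs E] := mean_value_from0 kd.
have [_ hx] := hball _ (inball _ xs).
have -> : h s - h 0 - s * dh 0 - s ^+ 2 / 2 * c = k s - k 0.
  by rewrite /k expr0n/= !mul0r !subr0; ring.
rewrite E normrM -[X in _ <= e * X]real_normK ?num_real// expr2 mulrA.
by rewrite ler_wpM2r// (le_trans hx)// ler_wpM2l// ltW.
Qed.

Lemma taylor2_line (U : set E2) (X : E2 -> E3) (u a : E2) (e : R) :
  open U -> smooth_on U X -> U u -> 0 < e ->
  \forall s \near (0 : R), `|X (u + s *: a) - X u - s *: 'D_a X u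
      - (s ^+ 2 / 2) *: 'D_a ('D_a X) u| <= e * s ^+ 2.
Proof.
move=> oU sX Uu e0.
have dX v : U v -> derivable X v a.
  by move=> Uv; apply: diff_derivable; case: (sX 1%N) => + _; exact.
have dDX v : U v -> derivable ('D_a X) v a.
  move=> Uv; apply: diff_derivable.
  by case: (sX 2%N) => _ /(_ a) [+ _]; exact.
have nU : \forall s \near (0 : R), U (u + s *: a).
  have c0 : {for 0, continuous (fun s : R => u + s *: a)}.
    by apply: cvgD; [exact: cvg_cst|exact: scalel_continuous].
  by apply: c0; rewrite scale0r addr0; exact: open_nbhs_nbhs.
suff H i : \forall s \near (0 : R), `|(X (u + s *: a) - X u -
    s *: 'D_a X u - (s ^+ 2 / 2) *: 'D_a ('D_a X) u) 0 i| <= e * s ^+ 2.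
  near=> s; apply: norm_le_coord => [|i].
    by rewrite mulr_ge0 ?sqr_ge0// ltW.
  by move: i; near: s; apply: filter_forall.
have := @taylor2 (fun s => X (u + s *: a) 0 i) (fun s => 'D_a X (u + s *: a) 0 i)
  ('D_a ('D_a X) u 0 i) e.
have u0 : u + 0 *: a = u by rewrite scale0r addr0.
case=> [|||d d0 hd]//.
- apply: filterS nU => s Us; apply: is_derive_coord; apply: is_derive_line.
  exact: dX.
- apply: is_derive_coord; rewrite -{2}u0; apply: is_derive_line; rewrite u0.
  exact: dDX.
have coordE (x y z w : E3) (r c : R) : (x - y - r *: z - c *: w) 0 i =
    x 0 i - y 0 i - r * z 0 i - c * w 0 i by rewrite !mxE.
exists d => // s /hd; rewrite /= u0 => hs.
by rewrite coordE.
Unshelve. all: by end_near. Qed.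

Lemma diff_partial (X : E2 -> E3) (u a : E2) : differentiable X u ->
  'd X u a = a 0 0 *: partial 0 X u + a 0 1 *: partial 1 X u.
Proof.
move=> dX; rewrite /partial !deriveE//.
rewrite {1}(row_sum_delta a) big_ord_recl big_ord1 linearD !linearZ /=.
by congr (_ + a 0 _ *: 'd X u (delta_mx 0 _)); apply/val_inj.
Qed.

(** The second derivative in a fixed direction as a quadratic form in that direction;
the mixed partial derivatives are kept apart, so that no symmetry is involved. *)
Lemma second_derive_partial (U : set E2) (X : E2 -> E3) (u a : E2) :
  open U -> smooth_on U X -> U u ->
  'D_a ('D_a X) u =
  a 0 0 *: (a 0 0 *: partial 0 (partial 0 X) u + a 0 1 *: partial 0 (partial 1 X) u) +
  a 0 1 *: (a 0 0 *: partial 1 (partial 0 X) u + a 0 1 *: partial 1 (partial 1 X) u).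
Proof.
move=> oU sX Uu.
have dX v : U v -> differentiable X v by case: (sX 1%N) => + _; exact.
have dDX (b : E2) : differentiable ('D_b X) u.
  by case: (sX 2%N) => _ /(_ b) [+ _]; exact.
have E : {near u, 'D_a X =1 a 0 0 *: partial 0 X + a 0 1 *: partial 1 X}.
  near=> v; rewrite deriveE; last by apply: dX; near: v; exact: open_nbhs_nbhs.
  by rewrite diff_partial//; apply: dX; near: v; exact: open_nbhs_nbhs.
have dP : differentiable (a 0 0 *: partial 0 X + a 0 1 *: partial 1 X) u.
  by apply: differentiableD; apply: differentiableZ; exact: dDX.
have Db b : 'D_b ('D_a X) u =
    a 0 0 *: 'D_b (partial 0 X) u + a 0 1 *: 'D_b (partial 1 X) u.
  have dP0 : derivable (partial 0 X) u b by apply: diff_derivable; exact: dDX.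
  have dP1 : derivable (partial 1 X) u b by apply: diff_derivable; exact: dDX.
  apply: etrans (near_eq_derive _ E) _.
  apply: etrans (deriveD (derivableZ dP0) (derivableZ dP1)) _.
  by congr (_ + _); exact: deriveZ.
apply: etrans (deriveE a (dDX a)) _.
apply: etrans (diff_partial a (dDX a)) _.
by congr (_ *: _ + _ *: _); exact: Db.
Unshelve. all: by end_near. Qed.

End SecondOrder.

(** * Fundamental forms as quadratic forms *)

Section FundamentalForms.
Context {R : realType}.
Local Notation E2 := 'rV[R]_2.
Local Notation E3 := 'rV[R]_3.

Definition quad (Q : 'M[R]_2) (a : E2) : R := (a *m Q *m a^T) 0 0.

Lemma mulmx2E m p (A : 'M[R]_(m, 2)) (B : 'M[R]_(2, p)) i j :
  (A *m B) i j = A i 0 * B 0 j + A i 1 * B 1 j.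
Proof.
rewrite mxE big_ord_recl big_ord1.
by congr (_ + A i _ * B _ j); apply/val_inj.
Qed.

Lemma quadE (Q : 'M[R]_2) (a : E2) :
  quad Q a = a 0 0 * (a 0 0 * Q 0 0 + a 0 1 * Q 0 1) +
             a 0 1 * (a 0 0 * Q 1 0 + a 0 1 * Q 1 1).
Proof. by rewrite /quad !mulmx2E !mxE; ring. Qed.

Lemma quadB (P Q : 'M[R]_2) a : quad (P - Q) a = quad P a - quad Q a.
Proof. by rewrite !quadE !mxE; ring. Qed.

Lemma quadZ (c : R) (Q : 'M[R]_2) a : quad (c *: Q) a = c * quad Q a.
Proof. by rewrite !quadE !mxE; ring. Qed.

Lemma quad_congr (B Q : 'M[R]_2) a : quad (B *m Q *m B^T) a = quad Q (a *m B).
Proof. by rewrite /quad trmx_mul !mulmxA. Qed.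

Lemma posdef_unitmx (P : 'M[R]_2) :
  (forall a, a != 0 -> 0 < quad P a) -> P \in unitmx.
Proof.
move=> posP; rewrite -row_free_unit; apply: inj_row_free => v vP.
apply/eqP; apply: contraT => /posP.
by rewrite /quad vP mul0mx mxE ltxx.
Qed.

(** In an orthonormal basis for P this is the trace of a nonnegative form.  The proof
is explicit: with delta = det P, P00 * delta * tr (P^-1 Q) equals
delta * Q(1, 0) + Q(- P01, P00).  Only P is assumed symmetric, as the second form
is not a priori so. *)
Lemma trace_quad_ge0 (P Q : 'M[R]_2) : P^T = P ->
  (forall a, a != 0 -> 0 < quad P a) -> (forall a, 0 <= quad Q a) ->
  0 <= \tr (invmx P *m Q).
Proof.
move=> symP posP posQ.
have s01 : P 1 0 = P 0 1 by rewrite -[in RHS]symP mxE.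
(* The entries of Q are written in terms of those of T, so that no formula for
   the inverse matrix is needed. *)
have EQ : Q = P *m (invmx P *m Q) by rewrite mulKVmx// posdef_unitmx.
set T := invmx P *m Q in EQ *.
have tr : \tr T = T 0 0 + T 1 1.
  rewrite /mxtrace big_ord_recl big_ord1.
  by congr (T _ _ + T _ _); apply/val_inj.
pose vec (x y : R) : E2 := \row_i (if i == 0 then x else y).
have q00 : Q 0 0 = P 0 0 * T 0 0 + P 0 1 * T 1 0 by rewrite {1}EQ mulmx2E.
have q01 : Q 0 1 = P 0 0 * T 0 1 + P 0 1 * T 1 1 by rewrite {1}EQ mulmx2E.
have q10 : Q 1 0 = P 0 1 * T 0 0 + P 1 1 * T 1 0 by rewrite {1}EQ mulmx2E s01.
have q11 : Q 1 1 = P 0 1 * T 0 1 + P 1 1 * T 1 1 by rewrite {1}EQ mulmx2E s01.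
have qv (M : 'M[R]_2) (x y : R) : quad M (vec x y) =
    x * (x * M 0 0 + y * M 0 1) + y * (x * M 1 0 + y * M 1 1).
  by rewrite quadE !mxE.
have e0 (x y : R) : x != 0 -> vec x y != 0.
  by apply: contra => /eqP/rowP/(_ 0); rewrite !mxE/= => ->.
have e1 (x y : R) : y != 0 -> vec x y != 0.
  by apply: contra => /eqP/rowP/(_ 1); rewrite !mxE/= => ->.
have p0 : 0 < P 0 0.
  by have := posP _ (e0 1 0 (oner_neq0 _)); rewrite qv !mul1r !mul0r !addr0.
have p1 : 0 < P 0 0 * P 1 1 - P 0 1 ^+ 2.
  have := posP _ (e1 (- P 0 1) (P 0 0) (lt0r_neq0 p0)); rewrite qv s01 => h.
  rewrite -(pmulr_rgt0 _ p0); apply: lt_le_trans h _.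
  by rewrite le_eqVlt; apply/orP; left; apply/eqP; ring.
have h0 := posQ (vec 1 0); have h1 := posQ (vec (- P 0 1) (P 0 0)).
rewrite !qv in h0 h1; rewrite -(pmulr_rge0 _ (mulr_gt0 p0 p1)) tr.
apply: le_trans (addr_ge0 (mulr_ge0 (ltW p1) h0) h1) _.
by rewrite le_eqVlt; apply/orP; left; apply/eqP; rewrite q00 q01 q10 q11; ring.
Qed.

Lemma first_formE (X : E2 -> E3) (u : E2) i j :
  first_form X u i j = dot (partial i X u) (partial j X u).
Proof. by rewrite mxE. Qed.

Lemma second_formE (X : E2 -> E3) (u : E2) (n : E3) i j :
  second_form X u n i j = - dot n (partial i (partial j X) u).
Proof. by rewrite mxE. Qed.

Lemma sym_first_form (X : E2 -> E3) (u : E2) :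
  (first_form X u)^T = first_form X u.
Proof.
apply/matrixP => i j; rewrite mxE; apply: etrans (first_formE _ _ _ _) _.
by apply: etrans (dotC _ _) _; exact/esym/first_formE.
Qed.

Lemma quad_first_form (X : E2 -> E3) (u a : E2) : differentiable X u ->
  quad (first_form X u) a = dot ('d X u a) ('d X u a).
Proof.
move=> dX; rewrite (diff_partial a dX) quadE !first_formE.
have G (x y : E3) (p q : R) :
    p * (p * dot x x + q * dot x y) + q * (p * dot y x + q * dot y y) =
    dot (p *: x + q *: y) (p *: x + q *: y).
  by rewrite !(dotDl, dotDr, dotZl, dotZr); ring.
exact: G.
Qed.

Lemma first_form_posdef (X : E2 -> E3) (u : E2) :
  differentiable X u -> injective ('d X u) ->
  forall a, a != 0 -> 0 < quad (first_form X u) a.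
Proof.
move=> dX injX a a0; rewrite quad_first_form//; apply: dot_gt0.
by apply: contra a0 => /eqP h; apply/eqP/injX; rewrite h linear0.
Qed.

Lemma quad_second_form (U : set E2) (X : E2 -> E3) (u a : E2) (n : E3) :
  open U -> smooth_on U X -> U u ->
  quad (second_form X u n) a = - dot n ('D_a ('D_a X) u).
Proof.
move=> oU sX Uu; rewrite (second_derive_partial a oU sX Uu) quadE !second_formE.
have G (x y z t : E3) (p q : R) :
    p * (p * - dot n x + q * - dot n y) + q * (p * - dot n z + q * - dot n t) =
    - dot n (p *: (p *: x + q *: y) + q *: (p *: z + q *: t)).
  by rewrite !(dotDr, dotZr); ring.
exact: G.
Qed.

(** The two tangent vectors and the normal are linearly independent, so that the
matrix with these rows is invertible; the inner product with n reads off the normal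
coefficient. *)
Lemma tangent_normal_decomposition (X : E2 -> E3) (u : E2) (n w : E3) :
  injective ('d X u) -> unit_normal X u n ->
  exists a, w = 'd X u a + dot w n *: n.
Proof.
move=> injX [n1 nX]; pose A := lin1_mx ('d X u).
have AE a : a *m A = 'd X u a by rewrite mul_rV_lin1.
pose M : 'M[R]_(2 + 1, 3) := col_mx A n.
have ME (v : 'rV[R]_(2 + 1)) : v *m M = 'd X u (lsubmx v) + rsubmx v 0 0 *: n.
  rewrite -{1}(hsubmxK v) mul_row_col AE; congr (_ + _).
  by rewrite {1}(mx11_scalar (rsubmx v)) mul_scalar_mx.
have dotM v : dot (v *m M) n = rsubmx v 0 0.
  by rewrite ME dotDl dotZl n1 mulr1 dotC nX add0r.
have uM : (M : 'M[R]_3) \in unitmx.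
  rewrite -row_free_unit; apply: inj_row_free => v vM.
  have r0 : rsubmx (v : 'rV[R]_(2 + 1)) 0 0 = 0 by rewrite -dotM vM dot0l.
  have l0 : lsubmx (v : 'rV[R]_(2 + 1)) = 0.
    have := ME v; rewrite vM r0 scale0r addr0 => /esym h.
    by apply: injX; rewrite linear0.
  rewrite -[LHS](@hsubmxK _ 1 2 1) l0.
  have -> : rsubmx (v : 'rV[R]_(2 + 1)) = 0.
    by apply/rowP => i; rewrite ord1 r0 mxE.
  by rewrite row_mx0.
pose v : 'rV[R]_(2 + 1) := w *m invmx (M : 'M[R]_3).
have vM : v *m M = w by rewrite /v mulmxKV.
by exists (lsubmx v); rewrite -{1}vM ME -dotM vM.
Qed.

End FundamentalForms.

(** * Quantitative injectivity of tangent frames *)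

Section LowerBound.
Context {R : realType}.
Local Notation E2 := 'rV[R]_2.
Local Notation E3 := 'rV[R]_3.

(** Completing the square in one variable bounds the form below by a multiple of the
square of the other one, and conversely. *)
Lemma posdef_lower_bound (P : 'M[R]_2) : P^T = P ->
  (forall a, a != 0 -> 0 < quad P a) ->
  exists2 m, 0 < m & forall a, m * `|a| ^+ 2 <= quad P a.
Proof.
move=> symP posP.
have s01 : P 1 0 = P 0 1 by rewrite -[in RHS]symP mxE.
pose d := P 0 0 * P 1 1 - P 0 1 ^+ 2.
pose vec (x y : R) : E2 := \row_i (if i == 0 then x else y).
have qv (x y : R) : quad P (vec x y) =
    x * (x * P 0 0 + y * P 0 1) + y * (x * P 1 0 + y * P 1 1).
  by rewrite quadE !mxE.
have e0 (x y : R) : x != 0 -> vec x y != 0.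
  by apply: contra => /eqP/rowP/(_ 0); rewrite !mxE/= => ->.
have e1 (x y : R) : y != 0 -> vec x y != 0.
  by apply: contra => /eqP/rowP/(_ 1); rewrite !mxE/= => ->.
have p0 : 0 < P 0 0.
  by have := posP _ (e0 1 0 (oner_neq0 _)); rewrite qv !mul1r !mul0r !addr0.
have p1 : 0 < P 1 1.
  by have := posP _ (e1 0 1 (oner_neq0 _)); rewrite qv !mul1r !mul0r !add0r.
have d0 : 0 < d.
  have := posP _ (e1 (- P 0 1) (P 0 0) (lt0r_neq0 p0)); rewrite qv s01 => h.
  rewrite -(pmulr_rgt0 _ p0); apply: lt_le_trans h _.
  by rewrite /d le_eqVlt; apply/orP; left; apply/eqP; ring.
pose m := Num.min (d / P 0 0) (d / P 1 1).
have m0 : 0 < m by rewrite lt_min !divr_gt0.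
exists m => // a.
have h0 : m * a 0 0 ^+ 2 <= quad P a.
  apply: (@le_trans _ _ (d / P 1 1 * a 0 0 ^+ 2)).
    by rewrite ler_wpM2r ?sqr_ge0// ge_min lexx orbT.
  rewrite -(ler_pM2l p1) quadE s01.
  have -> : P 1 1 * (d / P 1 1 * a 0 0 ^+ 2) = d * a 0 0 ^+ 2.
    by field; rewrite gt_eqF.
  rewrite -subr_ge0; apply: le_trans (sqr_ge0 (P 1 1 * a 0 1 + P 0 1 * a 0 0)) _.
  by rewrite le_eqVlt /d; apply/orP; left; apply/eqP; ring.
have h1 : m * a 0 1 ^+ 2 <= quad P a.
  apply: (@le_trans _ _ (d / P 0 0 * a 0 1 ^+ 2)).
    by rewrite ler_wpM2r ?sqr_ge0// ge_min lexx.
  rewrite -(ler_pM2l p0) quadE s01.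
  have -> : P 0 0 * (d / P 0 0 * a 0 1 ^+ 2) = d * a 0 1 ^+ 2.
    by field; rewrite gt_eqF.
  rewrite -subr_ge0; apply: le_trans (sqr_ge0 (P 0 0 * a 0 0 + P 0 1 * a 0 1)) _.
  by rewrite le_eqVlt /d; apply/orP; left; apply/eqP; ring.
have q0 : 0 <= quad P a by apply: le_trans h0; rewrite mulr_ge0 ?sqr_ge0// ltW.
have hn : `|a| <= Num.sqrt (quad P a / m).
  apply: norm_le_coord => [|i]; first exact: sqrtr_ge0.
  rewrite -sqrtr_sqr ler_wsqrtr// ler_pdivlMr// mulrC.
  by case: i => -[|[|//]] i2; [have -> : Ordinal i2 = 0 by apply/val_inj
     |have -> : Ordinal i2 = 1 by apply/val_inj].
have : `|a| ^+ 2 <= Num.sqrt (quad P a / m) ^+ 2.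
  by rewrite lerXn2r ?nnegrE ?sqrtr_ge0.
rewrite sqr_sqrtr; last by rewrite divr_ge0// ltW.
by rewrite ler_pdivlMr// mulrC.
Qed.

(** The map bounded here is the differential of a normal motion with speed k: its
tangential and normal parts are orthogonal, so the two squared norms add up. *)
Lemma normal_extension_lower_bound (X : E2 -> E3) (u : E2) (n : E3) (k : R) :
  differentiable X u -> injective ('d X u) -> unit_normal X u n -> 0 < k ->
  exists2 m, 0 < m & forall (v : E2) (h : R),
    m * `|(v, h)| <= `|'d X u v + (h * k) *: n|.
Proof.
move=> dX injX [n1 nX] k0.
have [m m0 hm] := posdef_lower_bound (sym_first_form X u) (first_form_posdef dX injX).
pose q := Num.sqrt (Num.min m (k ^+ 2) / 3).
have q0 : 0 < q by rewrite sqrtr_gt0 divr_gt0// lt_min m0 exprn_gt0.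
exists q => // v h; set w := _ + _.
have dw : dot w w = quad (first_form X u) v + (h * k) ^+ 2.
  rewrite quad_first_form// /w dotDl !dotDr !dotZl !dotZr n1.
  by rewrite [dot ('d X u v) n]dotC nX !mulr0 addr0 add0r mulr1 expr2.
have w3 : dot w w <= 3 * `|w| ^+ 2.
  by apply: le_trans (ler_norm _) _; rewrite expr2 mulrA dot_norm_le.
rewrite -(ler_pXn2r (n := 2))// ?nnegrE ?mulr_ge0 ?(ltW q0)//.
rewrite exprMn sqr_sqrtr; last by rewrite divr_ge0// le_min !ltW// exprn_gt0.
set mm := Num.min _ _.
have mm0 : 0 <= mm by rewrite le_min !ltW// exprn_gt0.
suff : mm * `|(v, h)| ^+ 2 <= dot w w.
  move=> h1; have h2 := le_trans h1 w3; rewrite mulrAC ler_pdivrMr//.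
  by rewrite [X in _ <= X]mulrC.
rewrite dw prod_normE /=.
have hv : mm * `|v| ^+ 2 <= quad (first_form X u) v.
  by apply: le_trans (hm v); rewrite ler_wpM2r ?sqr_ge0// ge_min lexx.
have hh : mm * `|h| ^+ 2 <= (h * k) ^+ 2.
  rewrite real_normK ?num_real// exprMn mulrC ler_wpM2l ?sqr_ge0//.
  by rewrite ge_min lexx orbT.
have v0 : 0 <= mm * `|v| ^+ 2 by rewrite mulr_ge0// sqr_ge0.
have h0 : 0 <= mm * `|h| ^+ 2 by rewrite mulr_ge0// sqr_ge0.
rewrite /Num.max; case: ifP => _.
  by apply: le_trans hh _; rewrite lerDr (le_trans v0).
by apply: le_trans hv _; rewrite lerDl sqr_ge0.
Qed.

End LowerBound.

(** * Critical points of the distance to a point *)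

Section SquaredDistance.
Context {R : realType}.
Local Notation E2 := 'rV[R]_2.
Local Notation E3 := 'rV[R]_3.

Lemma second_order_min (h dh : R -> R) (c : R) :
  (\forall s \near (0 : R), is_derive (s : R) (1 : R) h (dh s)) ->
  is_derive (0 : R) (1 : R) dh c ->
  (\forall s \near (0 : R), h 0 <= h s) -> dh 0 = 0 /\ 0 <= c.
Proof.
move=> hd dd hmin.
have key e : 0 < e -> exists2 d, 0 < d & forall s : R, `|s| < d ->
    0 <= s * dh 0 + s ^+ 2 * (c / 2 + e).
  move=> e0.
  have : nbhs (0 : R) [set s : R | h 0 <= h s /\
      `|h s - h 0 - s * dh 0 - s ^+ 2 / 2 * c| <= e * s ^+ 2].
    by apply: filterI => //; exact: taylor2.
  move=> /nbhs_ballP[d /= d0 hball]; exists d => // s sd.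
  have [|h1 h2] := hball s; first by rewrite -ball_normE/= sub0r normrN.
  have h3 := le_trans (ler_norm _) h2.
  rewrite -subr_ge0 in h1; apply: le_trans h1 _.
  by rewrite -subr_ge0; move: h3; rewrite -subr_ge0; congr (0 <= _); field.
have a0 : dh 0 = 0.
  apply/eqP; apply: contraT => an0; have [d d0 hd1] := key 1 ltr01.
  set a := dh 0 in an0 hd1.
  have na : 0 < `|a| by rewrite normr_gt0.
  pose q := 2 * (`|c| / 2 + 1).
  have q0 : 0 < q by rewrite mulr_gt0// addr_gt0// ?divr_ge0.
  (* At s = - r a the linear term - r a^2 wins over the quadratic one as soon as
     r q <= 1. *)
  pose r := Num.min (d / (2 * `|a|)) q^-1.
  have r0 : 0 < r by rewrite lt_min invr_gt0 q0 divr_gt0// mulr_gt0.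
  have rd : r * `|a| < d.
    apply: (@le_lt_trans _ _ (d / 2)); last by rewrite ltr_pdivrMr// ltr_pMr// ltr1n.
    rewrite -ler_pdivlMr//; apply: (@le_trans _ _ (d / (2 * `|a|))).
      by rewrite ge_min lexx.
    by rewrite invfM mulrA.
  have rq : r * q <= 1 by rewrite -ler_pdivlMr// mul1r ge_min lexx orbT.
  have := hd1 (- (r * a)); rewrite normrN normrM gtr0_norm// => /(_ rd).
  have -> : - (r * a) * a + (- (r * a)) ^+ 2 * (c / 2 + 1) =
      r * a ^+ 2 * (r * (c / 2 + 1) - 1) by ring.
  have a2 : 0 < a ^+ 2 by rewrite lt_neqAle sqr_ge0 andbT eq_sym sqrf_eq0.
  rewrite pmulr_rge0; last by rewrite mulr_gt0.
  have cc := ler_norm c; move: rq; rewrite /q => rq h1.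
  suff : r * (c / 2 + 1) < 1 by lra.
  have : r * (c / 2 + 1) <= r * (`|c| / 2 + 1) by rewrite ler_pM2l//; lra.
  have : 0 < r * (`|c| / 2 + 1) by rewrite mulr_gt0// ltr_wpDl// divr_ge0.
  by move: rq; set w := `|c| / 2 + 1; nra.
split=> //; rewrite leNgt; apply/negP => c0.
have [|d d0 hd1] := key (- c / 4); first by rewrite divr_gt0// oppr_gt0.
have := hd1 (d / 2); rewrite a0 mulr0 add0r gtr0_norm ?divr_gt0//.
rewrite ltr_pdivrMr// ltr_pMr// ltr1n => /(_ isT).
rewrite pmulr_rge0 ?exprn_gt0 ?divr_gt0//; lra.
Qed.

Lemma is_derive_dot (f g : R -> E3) (s : R) (df dg : E3) :
  is_derive s (1 : R) f df -> is_derive s (1 : R) g dg ->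
  is_derive s (1 : R) (fun r => dot (f r) (g r)) (dot df (g s) + dot (f s) dg).
Proof.
move=> hf hg.
have -> : (fun r => dot (f r) (g r)) =
    \sum_(i < 3) (fun r => f r 0 i) * (fun r => g r 0 i).
  by apply/funext => r; rewrite fct_sumE.
have D i : is_derive s (1 : R) ((fun r => f r 0 i) * (fun r => g r 0 i))
    (f s 0 i *: dg 0 i + g s 0 i *: df 0 i).
  by apply: is_deriveM; apply: is_derive_coord.
have -> : dot df (g s) + dot (f s) dg =
    \sum_(i < 3) (f s 0 i *: dg 0 i + g s 0 i *: df 0 i).
  rewrite /dot -big_split; apply: eq_bigr => i _ /=.
  by rewrite addrC /GRing.scale/= [df 0 i * _]mulrC.
exact: is_derive_sum.
Qed.

Definition sqdist (p q : E3) : R := dot (q - p) (q - p).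

Lemma sqdist_ge0 p q : 0 <= sqdist p q. Proof. exact: dot_ge0. Qed.

Lemma sqdist_eq0 p q : sqdist p q = 0 -> q = p.
Proof. by move/dot_eq0/eqP; rewrite subr_eq0 => /eqP. Qed.

(** The first and second derivative tests for the squared distance along the straight
lines through u. *)
Lemma sqdist_critical (U : set E2) (X : E2 -> E3) (u : E2) (p : E3) :
  open U -> smooth_on U X -> U u ->
  (\forall v \near u, sqdist p (X u) <= sqdist p (X v)) ->
  forall a, dot (X u - p) ('d X u a) = 0 /\
    0 <= dot ('d X u a) ('d X u a) + dot (X u - p) ('D_a ('D_a X) u).
Proof.
move=> oU sX Uu hmin a.
have dX v : U v -> differentiable X v by case: (sX 1%N) => + _; exact.
have dDX v : U v -> differentiable ('D_a X) v.
  by case: (sX 2%N) => _ /(_ a) [+ _]; exact.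
have u0 : u + 0 *: a = u by rewrite scale0r addr0.
have c0 : (fun s : R => u + s *: a) @ (0 : R) --> u.
  by rewrite -[X in _ --> X]u0; apply: cvgD; [exact: cvg_cst|exact: scalel_continuous].
have nU : \forall s \near (0 : R), U (u + s *: a).
  by apply: c0; exact: open_nbhs_nbhs.
have dline s : U (u + s *: a) ->
    is_derive s (1 : R) (fun r : R => X (u + r *: a) - p) ('D_a X (u + s *: a)).
  move=> Us.
  have h : is_derive s (1 : R) (fun r : R => X (u + r *: a)) ('D_a X (u + s *: a)).
    by apply: is_derive_line; apply: diff_derivable; exact: dX.
  have := is_deriveB h (is_derive_cst p s (1 : R)); rewrite subr0; exact.
have dline2 : is_derive (0 : R) (1 : R) (fun r : R => 'D_a X (u + r *: a))
    ('D_a ('D_a X) u).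
  rewrite -{2}u0; apply: is_derive_line; apply: diff_derivable.
  by rewrite u0; exact: dDX.
pose h (s : R) := sqdist p (X (u + s *: a)).
pose dh (s : R) := 2 * dot (X (u + s *: a) - p) ('D_a X (u + s *: a)).
have hd : \forall s \near (0 : R), is_derive (s : R) (1 : R) h (dh s).
  apply: filterS nU => s Us; have := is_derive_dot (dline _ Us) (dline _ Us).
  by rewrite /dh [dot ('D_a X _) _]dotC -mulr2n mulr_natl.
have dd := is_derive_dot (dline 0 _) dline2.
have {}dd := dd (eq_ind_r U Uu u0).
have dd2 : is_derive (0 : R) (1 : R) dh
    (2 * (dot ('D_a X u) ('D_a X u) + dot (X u - p) ('D_a ('D_a X) u))).
  by move: dd; rewrite u0 => dd; exact: (is_deriveZ 2 dd).
have hm : \forall s \near (0 : R), h 0 <= h s.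
  by rewrite /h u0; exact: (c0 _ hmin).
have [] := second_order_min hd dd2 hm.
rewrite /dh u0 => /eqP; rewrite mulf_eq0 pnatr_eq0 /= => /eqP h1.
rewrite pmulr_rge0// => h2.
have E : 'D_a X u = 'd X u a by apply: deriveE; exact: dX.
by split; rewrite -E.
Qed.

End SquaredDistance.

(** * Cones around a normal direction *)

Section Cones.
Context {R : realType}.
Local Notation E3 := 'rV[R]_3.

(** Height d and aperture M; by convexity such a cone is connected even though its
vertex is not part of it. *)
Definition cone (n : E3) (M d : R) : set E3 :=
  [set w | 0 < dot n w < d /\ `|w| <= M * dot n w].

(** The cone is convex and contains no point of the frontier of W, so that one point
outside the closure of W puts all of it outside. *)
Lemma cone_out_closure (W S : set E3) (n p w0 w1 : E3) (M d : R) :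
  frontier W `<=` S -> (forall w, cone n M d w -> ~ S (p + w)) ->
  cone n M d w0 -> ~ closure W (p + w0) -> cone n M d w1 ->
  ~ closure W (p + w1).
Proof.
move=> WS avoid c0 out0 c1.
have sub : segment (p + w0) (p + w1) `&` frontier W = set0.
  rewrite -subset0 => _ [[s /= /andP[s0 s1] <-]] /WS.
  have -> : p + w0 + s *: (p + w1 - (p + w0)) = p + (w0 + s *: (w1 - w0)).
    by rewrite opprD addrACA subrr add0r addrA.
  apply: avoid; case: c0 c1 => /andP[a0 b0] h0 [/andP[a1 b1] h1].
  have E : dot n (w0 + s *: (w1 - w0)) = (1 - s) * dot n w0 + s * dot n w1.
    by rewrite dotDr dotZr dotBr; ring.
  split; rewrite E.
    move: a0 b0 a1 b1; set x := dot n w0; set y := dot n w1 => a0 b0 a1 b1.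
    have s1' : 0 <= 1 - s by rewrite subr_ge0.
    have [xy|/ltW xy] := leP x y; rewrite -subr_ge0 in xy.
      by move: (mulr_ge0 s0 xy) (mulr_ge0 s1' xy) => h2 h3; apply/andP; split; lra.
    by move: (mulr_ge0 s0 xy) (mulr_ge0 s1' xy) => h2 h3; apply/andP; split; lra.
  have -> : w0 + s *: (w1 - w0) = (1 - s) *: w0 + s *: w1.
    by rewrite scalerBr scalerBl scale1r addrA addrAC.
  apply: le_trans (ler_normD _ _) _; rewrite !normrZ (ger0_norm s0).
  rewrite ger0_norm ?subr_ge0//.
  have g0 : (1 - s) * `|w0| <= (1 - s) * (M * dot n w0) by rewrite ler_wpM2l// subr_ge0.
  have g1 : s * `|w1| <= s * (M * dot n w1) by rewrite ler_wpM2l.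
  by lra.
have := connected_out_closure (@segment_rV_connected _ _ _) sub (segment_left _ _) out0.
move=> h cl; have : (segment (p + w0) (p + w1) `&` closure W) (p + w1).
  by split; [exact: segment_right|exact: cl].
by rewrite h.
Qed.

(** The sup norm is at most the Euclidean one. *)
Lemma unit_norm_le1 (n : E3) : dot n n = 1 -> `|n| <= 1.
Proof.
move=> n1; rewrite -(ler_pXn2r (n := 2))// ?nnegrE// expr1n -n1.
exact: norm_sqr_le_dot.
Qed.

Lemma unit_dot_le (n r : E3) : dot n n = 1 -> `|dot n r| <= 3 * `|r|.
Proof.
move=> /unit_norm_le1 n1; apply: le_trans (dot_norm_le _ _) _.
by rewrite ler_wpM2r// ler_piMr.
Qed.

End Cones.

(** * Balls that avoid a frontier *)

Section StarShaped.
Context {R : realType}.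
Local Notation E3 := 'rV[R]_3.
Implicit Types (p q : E3) (W S : set E3).

Lemma sqdist_segment p q z : segment p q z -> sqdist p z <= sqdist p q.
Proof.
move=> [s /= /andP[s0 s1] <-]; rewrite /sqdist addrAC subrr add0r dotZl dotZr mulrA.
rewrite -[X in _ <= X]mul1r ler_wpM2r ?dot_ge0//.
by rewrite mulr_ile1.
Qed.

Lemma segment_avoids S p q :
  (forall z, S z -> sqdist p q < sqdist p z) -> forall z, segment p q z -> ~ S z.
Proof. by move=> far z /sqdist_segment h /far; rewrite ltNge h. Qed.

(** The points of the segment from p to q are all at most as far from p as q is, so
the segment meets no point of S, nor of the frontier of W. *)
Lemma near_inside W S p q : frontier W `<=` S -> W p ->
  (forall z, S z -> sqdist p q < sqdist p z) -> W q.
Proof.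
move=> WS Wp far.
have sub : segment p q `&` frontier W = set0.
  by rewrite -subset0 => z [/(segment_avoids far) h /WS].
apply: (connected_sub_frontier (@segment_rV_connected _ _ _) sub).
  by exists p; split=> //; exact: segment_left.
exact: segment_right.
Qed.

Lemma near_outside W S p q : frontier W `<=` S -> ~ closure W p ->
  (forall z, S z -> sqdist p q < sqdist p z) -> ~ closure W q.
Proof.
move=> WS Wp far cq.
have sub : segment p q `&` frontier W = set0.
  by rewrite -subset0 => z [/(segment_avoids far) h /WS].
have E := connected_out_closure (@segment_rV_connected _ _ _) sub (segment_left _ _) Wp.
have : (segment p q `&` closure W) q by split; [exact: segment_right|exact: cq].
by rewrite E.
Qed.

End StarShaped.

(** * Comparison of mean curvatures at a point of contact *)

Section TangentialComparison.
Context {R : realType}.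
Local Notation E2 := 'rV[R]_2.
Local Notation E3 := 'rV[R]_3.

(** The Jacobian matrix acting on row vectors, which factors the first form as a Gram
matrix. *)
Definition tangent_matrix (X : E2 -> E3) (u : E2) : 'M[R]_(2, 3) :=
  \matrix_(i, j) partial i X u 0 j.

Lemma tangent_matrixE (X : E2 -> E3) (u : E2) i j :
  tangent_matrix X u i j = partial i X u 0 j.
Proof. by rewrite mxE. Qed.

Lemma first_form_tangent (X : E2 -> E3) (u : E2) :
  first_form X u = tangent_matrix X u *m (tangent_matrix X u)^T.
Proof.
apply/matrixP => i j; apply: etrans (first_formE _ _ _ _) _.
rewrite [RHS]mxE; apply: eq_bigr => k _.
by rewrite [_^T k j]mxE !tangent_matrixE.
Qed.

Lemma mul_tangent_matrix (X : E2 -> E3) (u a : E2) : differentiable X u ->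
  a *m tangent_matrix X u = 'd X u a.
Proof.
move=> dX; rewrite (diff_partial a dX); apply/rowP => j.
rewrite mulmx2E !tangent_matrixE.
have coordE (x y : E3) (p q : R) :
  p * x 0 j + q * y 0 j = (p *: x + q *: y) 0 j by rewrite !mxE.
exact: coordE.
Qed.

Lemma trace_congr (A P Q S : 'M[R]_2) : P = A *m Q *m A^T ->
  Q \in unitmx -> A \in unitmx -> P \in unitmx ->
  \tr (invmx P *m (A *m S *m A^T)) = \tr (invmx Q *m S).
Proof.
move=> PE uQ uA uP.
have -> : A *m S *m A^T = P *m (invmx A^T *m (invmx Q *m S) *m A^T).
  by rewrite PE !mulmxA mulmxK ?unitmx_tr// mulmxK.
rewrite mulKmx// mxtrace_mulC mulKVmx ?unitmx_tr//.

Qed.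

(** Both maps have the same tangent plane, since they share the normal n, and so the
tangent frame of f is A times that of X for an invertible A.  The hypothesis says
that the second form of f minus that of X, transported by A, is nonnegative, and
mean curvatures are the traces of these forms with respect to the common first
form. *)
Lemma mean_curvature_comparison (U V : set E2) (f X : E2 -> E3) (u v : E2) (n : E3) :
  open U -> immersion_on U f -> U u -> open V -> immersion_on V X -> V v ->
  unit_normal f u n -> unit_normal X v n ->
  (forall a b, 'd f u a = 'd X v b ->
    dot n ('D_a ('D_a f) u) <= dot n ('D_b ('D_b X) v)) ->
  mean_curvature X v n <= mean_curvature f u n.
Proof.
move=> oU [sf injf] Uu oV [sX injX] Vv [n1 nf] nX hess.
have df : differentiable f u by case: (sf 1%N) => + _; exact.
have dX : differentiable X v by case: (sX 1%N) => + _; exact.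
have tang (a : E2) : exists b, 'd f u a = 'd X v b.
  have [b E] := tangent_normal_decomposition ('d f u a) (injX _ Vv) nX.
  by exists b; rewrite {1}E [dot _ n]dotC nf scale0r addr0.
have [b0 E0] := tang (delta_mx 0 0); have [b1 E1] := tang (delta_mx 0 1).
pose A : 'M[R]_2 := \matrix_(i, j) (if i == 0 then b0 0 j else b1 0 j).
have AE (a : E2) : a *m A = a 0 0 *: b0 + a 0 1 *: b1.
  by apply/rowP => j; rewrite mulmx2E !mxE.
have dA (a : E2) : 'd f u a = 'd X v (a *m A).
  have L (p q : R) : 'd X v (p *: b0 + q *: b1) = p *: 'd X v b0 + q *: 'd X v b1.
    by rewrite linearD !linearZ.
  apply: etrans (diff_partial a df) _.
  apply: etrans (esym (etrans (congr1 _ (AE a)) (L _ _))).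
  congr (_ *: _ + _ *: _); first exact: etrans (deriveE _ df) E0.
  exact: etrans (deriveE _ df) E1.
have JA : tangent_matrix f u = A *m tangent_matrix X v.
  apply/row_matrixP => i; rewrite !rowE mulmxA.
  by rewrite mul_tangent_matrix// mul_tangent_matrix.
have PE : first_form f u = A *m first_form X v *m A^T.
  by rewrite !first_form_tangent JA trmx_mul !mulmxA.
have posf := first_form_posdef df (injf _ Uu).
have uP := posdef_unitmx posf.
have uI := posdef_unitmx (first_form_posdef dX (injX _ Vv)).
have uA : A \in unitmx by move: uP; rewrite PE -mulmxA unitmx_mul => /andP[].
pose II := second_form X v n.
have Q a : 0 <= quad (second_form f u n - A *m II *m A^T) a.
  have flip (x y x' y' : R) : x = - x' -> y = - y' -> x' <= y' -> y <= x.
    by move=> -> ->; rewrite lerN2.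
  rewrite quadB quad_congr subr_ge0.
  apply: flip (quad_second_form a n oU sf Uu) _ (hess _ _ (dA a)).
  exact: (quad_second_form (a *m A) n oV sX Vv).
have := trace_quad_ge0 (sym_first_form f u) posf Q.
rewrite mulmxBr raddfB /= subr_ge0; apply: le_trans.
by rewrite (trace_congr II PE uI uA uP).
Qed.

(** A curve that equals om s^k up to o(s^k), k > 0, with om on the positive side of n,
stays for small s > 0 in a cone of the aperture of om, enlarged to absorb the
error term.  The aperture must not depend on d, as [cone_outside_hull] fixes d
only after M. *)
Lemma higher_order_in_cone (w : R -> E3) (om n : E3) (k : nat) :
  dot n n = 1 -> 0 < dot n om ->
  (forall e, 0 < e -> \forall s \near (0 : R)^'+,
     `|w s - (s ^+ k.+1) *: om| <= e * s ^+ k.+1) ->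
  exists2 M, 2 <= M & forall d, 0 < d -> \forall s \near (0 : R)^'+, cone n M d (w s).
Proof.
move=> n1 b0 hw; set b := dot n om in b0.
pose C := `|om| + 1; have C0 : 0 < C by rewrite ltr_wpDl.
exists (Num.max 2 (2 * C / b)); first by rewrite le_max lexx.
move=> d d0; pose e := Num.min 1 (b / 6).
have e0 : 0 < e by rewrite lt_min ltr01 divr_gt0.
have e1 : e <= 1 by rewrite ge_min lexx.
have e2 : e <= b / 6 by rewrite ge_min lexx orbT.
have small : \forall s \near (0 : R)^'+, s < Num.min 1 (d / (3 * C)).
  by apply: nbhs_right_lt; rewrite lt_min ltr01 divr_gt0// mulr_gt0.
have pos : \forall s \near (0 : R)^'+, 0 < s by exact: nbhs_right_gt.
near=> s.
have s0 : 0 < s by near: s.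
have : s < Num.min 1 (d / (3 * C)) by near: s.
rewrite lt_min => /andP[s1 sd].
have : `|w s - (s ^+ k.+1) *: om| <= e * s ^+ k.+1 by near: s; exact: hw.
set q := s ^+ k.+1 => h.
have q0 : 0 < q by rewrite exprn_gt0.
have qs : q <= s by rewrite /q exprS ler_piMr ?exprn_ile1// ltW.
have ws : `|w s| <= q * C.
  rewrite -[w s](subrK (q *: om)); apply: le_trans (ler_normD _ _) _.
  rewrite normrZ gtr0_norm// /C mulrDr mulr1 addrC lerD//.
  by apply: le_trans h _; rewrite ler_piMl// ltW.
have E : dot n (w s) = q * b + dot n (w s - q *: om).
  by rewrite dotBr dotZr addrC subrK.
have h1 := le_trans (unit_dot_le (w s - q *: om) n1) (ler_wpM2l (ler0n _ 3) h).
move: h1; rewrite ler_norml => /andP[h2 h3].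
have h4 : 3 * (e * q) <= q * b / 2.
  have : e * q <= b / 6 * q by rewrite ler_pM2r.
  by move=> ?; lra.
have low : q * b / 2 <= dot n (w s) by rewrite E; lra.
have qb : 0 < q * b by rewrite mulr_gt0.
split.
  apply/andP; split; first by lra.
  apply: le_lt_trans (ler_norm _) _; apply: le_lt_trans (unit_dot_le _ n1) _.
  move: sd; rewrite ltr_pdivlMr ?mulr_gt0// => sd.
  have : q * C <= s * C by rewrite ler_pM2r.
  by move=> ?; lra.
apply: le_trans ws _; apply: (@le_trans _ _ (2 * C / b * dot n (w s))).
  have -> : q * C = 2 * C / b * (q * b / 2) by field; rewrite gt_eqF.
  by rewrite ler_pM2l// divr_gt0// mulr_gt0.
rewrite ler_wpM2r//; first by lra.
by rewrite le_max lexx orbT.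
Unshelve. all: by end_near. Qed.

(** The two expansions have the form that [higher_order_in_cone] expects, with om the
first derivative of one curve here, and half the difference of the second
derivatives of two curves in [expansion_order2]. *)
Lemma expansion_order1 (U : set E2) (f : E2 -> E3) (u a : E2) (e : R) :
  open U -> smooth_on U f -> U u -> 0 < e ->
  \forall s \near (0 : R)^'+,
    `|f (u + s *: a) - f u - (s ^+ 1) *: 'D_a f u| <= e * s ^+ 1.
Proof.
move=> oU sf Uu e0; pose C := `|'D_a ('D_a f) u| / 2 + 1.
have C0 : 0 < C by rewrite ltr_wpDl// divr_ge0.
have T := taylor2_line a oU sf Uu ltr01.
have {}T : \forall s \near (0 : R)^'+, `|f (u + s *: a) - f u - s *: 'D_a f u
      - (s ^+ 2 / 2) *: 'D_a ('D_a f) u| <= 1 * s ^+ 2 by exact: cvg_within T.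
near=> s; rewrite !expr1.
have s0 : 0 < s by near: s; exact: nbhs_right_gt.
have sC : s < e / C by near: s; apply: nbhs_right_lt; rewrite divr_gt0.
have : `|f (u + s *: a) - f u - s *: 'D_a f u - (s ^+ 2 / 2) *: 'D_a ('D_a f) u|
    <= 1 * s ^+ 2 by near: s; exact: T.
rewrite mul1r; set x := _ - s *: _; set Z := 'D_a ('D_a f) u => h.
rewrite -[x](subrK ((s ^+ 2 / 2) *: Z)); apply: le_trans (ler_normD _ _) _.
have s2 : 0 < s ^+ 2 by rewrite exprn_gt0.
rewrite normrZ gtr0_norm ?divr_gt0//.
have : s * C <= e by rewrite -ler_pdivlMr// ltW.
move=> sCe; have : s * (s * C) <= s * e by rewrite ler_pM2l.
by move: h; rewrite /C expr2; set y := `|x - _|; set z := `|Z|; lra.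
Unshelve. all: by end_near. Qed.

Lemma expansion_order2 (U V : set E2) (f X : E2 -> E3) (u v a b : E2) (e : R) :
  open U -> smooth_on U f -> U u -> open V -> smooth_on V X -> V v ->
  f u = X v -> 'D_a f u = 'D_b X v -> 0 < e ->
  \forall s \near (0 : R)^'+,
    `|f (u + s *: a) - X (v + s *: b) - (s ^+ 2) *:
      (2^-1 *: ('D_a ('D_a f) u - 'D_b ('D_b X) v))| <= e * s ^+ 2.
Proof.
move=> oU sf Uu oV sX Vv fX DfX e0; have e2 : 0 < e / 2 by rewrite divr_gt0.
have Tf : \forall s \near (0 : R)^'+, `|f (u + s *: a) - f u - s *: 'D_a f u
      - (s ^+ 2 / 2) *: 'D_a ('D_a f) u| <= e / 2 * s ^+ 2.
  exact: cvg_within (taylor2_line a oU sf Uu e2).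
have TX : \forall s \near (0 : R)^'+, `|X (v + s *: b) - X v - s *: 'D_b X v
      - (s ^+ 2 / 2) *: 'D_b ('D_b X) v| <= e / 2 * s ^+ 2.
  exact: cvg_within (taylor2_line b oV sX Vv e2).
apply: filterS (filterI Tf TX) => s [hf hX]; move: hf hX; rewrite fX DfX.
move: (f (u + s *: a)) (X (v + s *: b)) (X v) ('D_b X v) => p q x D.
move: ('D_a ('D_a f) u) ('D_b ('D_b X) v) => Y Z hf hX.
have -> : p - q - s ^+ 2 *: (2^-1 *: (Y - Z)) =
    (p - x - s *: D - (s ^+ 2 / 2) *: Y) - (q - x - s *: D - (s ^+ 2 / 2) *: Z).
  by apply/rowP => i; rewrite !mxE; ring.
apply: le_trans (ler_normB _ _) _; apply: le_trans (lerD hf hX) _.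
by rewrite -mulrDl -splitr.
Qed.

End TangentialComparison.

(** * The unit disk *)

Section Disks.
Context {R : realType}.
Local Notation E2 := 'rV[R]_2.
Local Notation E3 := 'rV[R]_3.

Lemma continuous_sqnorm : continuous (fun u : E2 => dot u u).
Proof. by move=> u; exact: (continuous_dot (@cvg_id _ _) (@cvg_id _ _)). Qed.

Lemma open_unit_disk : open (@unit_disk R).
Proof.
have -> : @unit_disk R = (fun u : E2 => dot u u) @^-1` [set x : R | x < 1] by [].
by apply: open_comp; [move=> u _; exact: continuous_sqnorm|exact: open_lt].
Qed.

Lemma compact_closed_disk : compact (@closed_disk R 1).
Proof.
apply: bounded_closed_compact.
  exists 1; split=> // M M1 u; rewrite /closed_disk /= expr1n => u1.
  apply: le_trans (ltW M1); rewrite -(ler_pXn2r (n := 2))// ?nnegrE// expr1n.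
  exact: le_trans (norm_sqr_le_dot u) u1.
have -> : @closed_disk R 1 = (fun u : E2 => dot u u) @^-1` [set x : R | x <= 1 ^+ 2].
  by [].
by apply: closed_comp; [move=> u _; exact: continuous_sqnorm|exact: closed_le].
Qed.

Lemma closed_disk1P (u : E2) : closed_disk 1 u -> unit_disk u \/ unit_circle u.
Proof.
rewrite /closed_disk /= expr1n le_eqVlt => /orP[/eqP|]; first by right.
by left.
Qed.

End Disks.

(** * The differential of the flow in space and time *)

Section Flow.
Context {R : realType} (N : closedSurface R) (F : N -> R -> 'rV[R]_3)
  (nu : N -> R -> 'rV[R]_3).
Local Notation E2 := 'rV[R]_2.
Local Notation E3 := 'rV[R]_3.

(** The part of inverse mean curvature flow on [0, +oo) that does not involve the
initial domain; nu is the chosen unit normal field. *)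
Definition flow_equation : Prop :=
  [/\ forall c : set E2 * (E2 -> N), atlas c ->
        smooth_within (c.1 `*` [set t : R | 0 <= t])
          (fun p : E2 * R => F (c.2 p.1) p.2),
      forall t : R, 0 <= t -> immersion (F ^~ t) &
      forall (c : set E2 * (E2 -> N)) (u : E2) (t : R), atlas c -> c.1 u -> 0 <= t ->
        let X := fun v => F (c.2 v) t in
        let x := c.2 u in
        let H := mean_curvature X u (nu x t) in
        [/\ unit_normal X u (nu x t), 0 < H &
            (s - t)^-1 *: (F x s - F x t)
              @[s --> within [set t : R | 0 <= t] t^'] --> H^-1 *: nu x t]].

Hypothesis flow : flow_equation.

(** The one-sided time derivative determines the value of the differential of a smooth
extension g on the time direction, also at t = 0: strict differentiability of g
compares both with the same difference quotient at some t + r, r > 0. *)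
Lemma smooth_extension_time_derivative (c : set E2 * (E2 -> N)) (u : E2) (t : R)
    (U : set (E2 * R)) (g : E2 * R -> E3) :
  atlas c -> c.1 u -> 0 <= t -> open U -> U (u, t) -> smooth_on U g ->
  (forall q, U q -> (c.1 `*` [set t : R | 0 <= t]) q -> g q = F (c.2 q.1) q.2) ->
  'd g (u, t) (0, 1) =
    (mean_curvature (fun v => F (c.2 v) t) u (nu (c.2 u) t))^-1 *: nu (c.2 u) t.
Proof.
move=> ac cu t0 oU Up sg gF; case: flow => _ _ /(_ c u t ac cu t0) /= [_ _ lim].
set y := _ *: _ in lim *.
apply/eqP; rewrite -subr_eq0 -normr_eq0; apply/eqP.
apply/eqP; rewrite eq_le normr_ge0 andbT; apply/ler_addgt0Pr => e e0; rewrite add0r.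
have e2 : 0 < e / 2 by rewrite divr_gt0.
have [d d0 sd] := strict_differentiability oU sg Up e2.
have /cvgrPdist_le/(_ _ e2) := lim.
rewrite near_withinE => /nbhs_ballP[d1 /= d10 h1].
have /nbhs_ballP[d2 /= d20 h2] : nbhs (u, t) U by exact: open_nbhs_nbhs.
pose r := Num.min d (Num.min d1 d2) / 2.
have mn0 : 0 < Num.min d (Num.min d1 d2) by rewrite !lt_min d0 d10 d20.
have r0 : 0 < r by rewrite divr_gt0.
have rlt : r < Num.min d (Num.min d1 d2) by rewrite ltr_pdivrMr// ltr_pMr// ltr1n.
move: rlt; rewrite !lt_min => /andP[rd /andP[rd1 rd2]].
have Us : U (u, t + r).
  apply: h2; split; rewrite -ball_normE/= ?subrr ?normr0//.
  by rewrite opprD addNKr normrN gtr0_norm.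
have gs : g (u, t + r) = F (c.2 u) (t + r).
  by rewrite gF//; split=> //=; rewrite addr_ge0// ltW.
have gt : g (u, t) = F (c.2 u) t by rewrite gF.
have {}h1 : `|y - r^-1 *: (F (c.2 u) (t + r) - F (c.2 u) t)| <= e / 2.
  have := h1 (t + r); rewrite [t + r - t]addrAC subrr add0r; apply.
  - by rewrite /ball/= opprD addNKr normrN gtr0_norm.
  - by rewrite gt_eqF// ltrDl.
  - by rewrite /= addr_ge0// ltW.
have pd : (u, t + r) - (u, t) = (0, r) :> E2 * R.
  by congr pair; rewrite /= ?subrr// addrAC subrr add0r.
have nr : `|(0, r) : E2 * R| = r.
  by rewrite prod_normE /= normr0 gtr0_norm// max_r// ltW.
have := sd (u, t + r) (u, t); rewrite pd nr subrr normr0 gs gt => /(_ rd d0) h3.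
have lr : 'd g (u, t) (0, r) = r *: 'd g (u, t) (0, 1).
  rewrite -linearZ; congr ('d g (u, t) _).
  by congr pair; rewrite /= ?scaler0// [r *: 1]mulr1.
move: h3; rewrite lr; move: ('d g (u, t) (0, 1)) => L h3.
have h4 : `|r^-1 *: (F (c.2 u) (t + r) - F (c.2 u) t) - L| <= e / 2.
  rewrite -(ler_pM2l r0) [X in _ <= X]mulrC; apply: le_trans h3.
  rewrite -[X in X * _](gtr0_norm r0) -normrZ scalerBr scalerA divff ?gt_eqF//.
  by rewrite scale1r.
rewrite [e]splitr -[L - y]opprB normrN.
rewrite -(subrKA (r^-1 *: (F (c.2 u) (t + r) - F (c.2 u) t))).
by apply: le_trans (ler_normD _ _) _; apply: lerD.
Qed.

Lemma smooth_extension_space_derivative (c : set E2 * (E2 -> N)) (u v : E2) (t : R)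
    (U : set (E2 * R)) (g : E2 * R -> E3) :
  atlas c -> c.1 u -> 0 <= t -> open U -> U (u, t) -> smooth_on U g ->
  (forall q, U q -> (c.1 `*` [set t : R | 0 <= t]) q -> g q = F (c.2 q.1) q.2) ->
  'd g (u, t) (v, 0) = 'd (fun v => F (c.2 v) t) u v.
Proof.
move=> ac cu t0 oU Up sg gF.
have dg : differentiable g (u, t) by case: (sg 1%N) => + _; exact.
have [oc _ _ _] := surface_chart ac.
have dX : differentiable (fun v => F (c.2 v) t) u.
  case: flow => _ /(_ t t0) /(_ c ac) [+ _] _.
  by move=> /(_ 1%N) [+ _]; exact.
rewrite -!deriveE//.
have E : \forall w \near u, F (c.2 w) t = g (w, t).
  have /nbhs_ballP[d /= d0 hd] : nbhs (u, t) U by exact: open_nbhs_nbhs.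
  have nU : \forall w \near u, U (w, t).
    apply/nbhs_ballP; exists d => // w uw; apply: hd; split=> //=.
    exact: ballxx.
  have nc : \forall w \near u, c.1 w by exact: open_nbhs_nbhs.
  apply: filterS (filterI nU nc) => w [Uw cw']; rewrite gF//.
symmetry; refine (etrans (near_eq_derive v E) _).
have slice : (fun h : R => h^-1 *: (((fun w : E2 => g (w, t)) \o shift u) (h *: v)
      - g (u, t))) =
    (fun h : R => h^-1 *: ((g \o shift (u, t)) (h *: (v, 0)) - g (u, t))).
  apply/funext => h /=; congr (_ *: (g _ - _)); congr pair => /=.
  by rewrite scaler0 add0r.
by rewrite /derive slice.
Qed.

Definition chart_inv (c : set E2 * (E2 -> N)) (x : N) : E2 :=
  xget 0 [set u | c.1 u /\ c.2 u = x].

Lemma chart_invK (c : set E2 * (E2 -> N)) (u : E2) :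
  atlas c -> c.1 u -> chart_inv c (c.2 u) = u.
Proof.
move=> ac cu; have [_ inj _ _] := surface_chart ac.
apply: xget_unique; first by [].
by move=> v [cv E]; apply: inj; rewrite ?inE.
Qed.

Lemma chart_nbhs (c : set E2 * (E2 -> N)) (u : E2) (V : set E2) :
  atlas c -> c.1 u -> nbhs u V -> nbhs (c.2 u) (c.2 @` (V `&` c.1)).
Proof.
move=> ac cu; move=> nV; pose W := interior V.
have oW : open W by exact: open_interior.
have Wu : W u by [].
have WV : W `<=` V by exact: interior_subset.
have [oc _ _ om] := surface_chart ac.
have : open (c.2 @` (W `&` c.1)) by apply: om; [exact: openI|move=> v []].
move=> oO; have : nbhs (c.2 u) (c.2 @` (W `&` c.1)).
  by apply: open_nbhs_nbhs; split=> //; exists u.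
by apply: filterS; move=> _ [v [Wv cv] <-]; exists v => //; split=> //; exact: WV.
Qed.

(** The normal speed of the surface, in the chart c. *)
Definition speed (c : set E2 * (E2 -> N)) (u : E2) (t : R) : R :=
  (mean_curvature (fun v => F (c.2 v) t) u (nu (c.2 u) t))^-1.

Lemma flow_frame (c : set E2 * (E2 -> N)) (u : E2) (t : R) :
  atlas c -> c.1 u -> 0 <= t ->
  [/\ open c.1, smooth_on c.1 (fun v => F (c.2 v) t),
      differentiable (fun v => F (c.2 v) t) u /\
        injective ('d (fun v => F (c.2 v) t) u),
      unit_normal (fun v => F (c.2 v) t) u (nu (c.2 u) t) & 0 < speed c u t].
Proof.
move=> ac cu t0; have [oc _ _ _] := surface_chart ac.
case: flow => _ /(_ t t0 c ac) [sX injX] /(_ c u t ac cu t0) /= [un H0 _].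
split=> //; last by rewrite invr_gt0.
by split; [case: (sX 1%N) => + _; exact|exact: injX].
Qed.

(** All that is used of the smoothness of F in space-time.  In the coordinate kap on N
the flow is strictly differentiable at (x0, t0), with a differential that sends
(v, h) to a tangent vector plus h times the normal velocity and is bounded above
and below.  It is the differential of a smooth extension, so that t0 = 0 is no
exception. *)
Lemma flow_strict (c : set E2 * (E2 -> N)) (u0 : E2) (t0 : R) :
  atlas c -> c.1 u0 -> 0 <= t0 ->
  let x0 := c.2 u0 in let n := nu x0 t0 in let k := speed c u0 t0 in
  let D := 'd (fun v => F (c.2 v) t0) u0 in
  exists (kap : N -> E2) (m M : R),
  [/\ 0 < m /\ 0 < M,
      forall v h, m * `|(v, h)| <= `|D v + (h * k) *: n|,
      forall v h, `|D v + (h * k) *: n| <= M * `|(v, h)|,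
      (kap @ x0 --> kap x0) /\ exists2 O, nbhs x0 O &
        forall x y, O x -> O y -> kap x = kap y -> x = y &
      forall e, 0 < e -> exists2 O, nbhs x0 O & exists2 d, 0 < d &
        forall x y s t, O x -> O y -> `|s - t0| < d -> `|t - t0| < d ->
        0 <= s -> 0 <= t ->
        `|F x s - F y t - (D (kap x - kap y) + ((s - t) * k) *: n)| <=
          e * `|(kap x - kap y, s - t)|].
Proof.
move=> ac cu0 t00 /=.
case: (flow) => /(_ c ac (u0, t0)) sm _ _.
have [|U [g [oU Up sg gF]]] := sm; first by [].
pose X := fun v => F (c.2 v) t0.
have [_ _ [dX injX] un k0] := flow_frame ac cu0 t00.
set n := nu (c.2 u0) t0 in un *; set k := speed _ _ _ in k0 *.
have [m m0 hm] := normal_extension_lower_bound dX injX un k0.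
have gF' q : U q -> (c.1 `*` [set t : R | 0 <= t]) q -> g q = F (c.2 q.1) q.2.
  exact: gF.
have Dt := smooth_extension_time_derivative ac cu0 t00 oU Up sg gF'.
have Ds v := smooth_extension_space_derivative v ac cu0 t00 oU Up sg gF'.
have DE (v : E2) (h : R) : 'd g (u0, t0) (v, h) = 'd X u0 v + (h * k) *: n.
  have -> : (v, h) = (v, 0) + h *: (0, 1) :> E2 * R.
    by congr pair; rewrite /= ?scaler0 ?addr0// add0r [h *: 1]mulr1.
  rewrite linearD; congr (_ + _); first exact: Ds.
  by rewrite linearZ /= -scalerA; congr (_ *: _); exact: Dt.
have dg : differentiable g (u0, t0) by case: (sg 1%N) => + _; exact.
have [M M0 hM] := linear_lipschitz (diff_continuous dg).
exists (chart_inv c), m, M; split=> //.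
  by move=> v h; move: (DE v h) (hM (v, h)) => ->.
  split.
    rewrite chart_invK// => B /(chart_nbhs ac cu0).
    by apply: filterS; move=> _ [v [Bv cv] <-] /=; rewrite chart_invK.
  exists (c.2 @` c.1).
    by rewrite -[c.1]setTI; apply: chart_nbhs => //; exact: filterT.
  by move=> _ _ [u cu <-] [v cv <-]; rewrite !chart_invK// => ->.
move=> e e0; have [d d0 sd] := strict_differentiability oU sg Up e0.
have /nbhs_ballP[d2 /= d20 h2] : nbhs (u0, t0) U by exact: open_nbhs_nbhs.
pose r := Num.min d d2; have r0 : 0 < r by rewrite lt_min d0 d20.
exists (c.2 @` (ball u0 r `&` c.1)).
  by apply: chart_nbhs => //; exact: nbhsx_ballx.
exists r => // _ _ s t [u [bu cu] <-] [v [bv cv] <-] sr tr s0 tt0.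
rewrite !chart_invK//.
have close w q : ball u0 r w -> c.1 w -> `|q - t0| < r -> 0 <= q ->
    g (w, q) = F (c.2 w) q /\ `|(w, q) - (u0, t0)| < d.
  rewrite -ball_normE/= distrC lt_min => /andP[wd wd2] cw.
  rewrite lt_min => /andP[qd qd2] q0; split.
    rewrite gF//; apply: h2; rewrite -ball_normE/= distrC prod_normE/=.
    by rewrite gt_max wd2 qd2.
  by rewrite prod_normE/= gt_max wd qd.
have [gu du] := close u s bu cu sr s0; have [gv dv] := close v t bv cv tr tt0.
have := sd _ _ du dv; rewrite gu gv.
by move: (DE (u - v) (s - t)) => <-.
Qed.

(** * Continuity and local injectivity *)

Lemma flow_near (x0 : N) (t0 e : R) : 0 <= t0 -> 0 < e ->
  exists2 O, nbhs x0 O & exists2 d, 0 < d & forall x t, O x ->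
    `|t - t0| < d -> 0 <= t -> `|F x t - F x0 t0| < e.
Proof.
have [c ac [u cu <-{x0}]] := surface_cover x0; move=> t00 e0.
have [kap [m [M [[m0 M0] _ hM [ck _] strict]]]] := flow_strict ac cu t00.
have [B nB [d d0 hd]] := strict 1 ltr01.
have M1 : 0 < M + 1 by rewrite addr_gt0.
pose r := e / (M + 1); have r0 : 0 < r by rewrite divr_gt0.
have near_kap : nbhs (c.2 u) [set x : N | `|kap x - kap (c.2 u)| < r].
  by have /cvgrPdist_lt/(_ _ r0) := ck; apply: filterS; move=> x; rewrite /= distrC.
exists (B `&` [set x : N | `|kap x - kap (c.2 u)| < r]); first exact: filterI.
exists (Num.min d r); first by rewrite lt_min d0 r0.
move=> x t [Bx kx]; rewrite lt_min => /andP[td tr] t0'.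
have := hd x (c.2 u) t t0 Bx (nbhs_singleton nB) td; rewrite subrr normr0.
move=> /(_ d0 t0' t00); rewrite mul1r => h.
have bound (A L : E3) (z : R) : `|A - L| <= z -> `|L| <= M * z -> z < r -> `|A| < e.
  move=> h1 h2 zr; rewrite -[A](subrK L); apply: le_lt_trans (ler_normD _ _) _.
  apply: (@le_lt_trans _ _ ((M + 1) * z)); first by rewrite mulrDl mul1r addrC lerD.
  by rewrite mulrC -ltr_pdivlMr.
apply: bound h (hM _ _) _; rewrite prod_normE/= gt_max tr andbT.
exact: kx.
Qed.

(** Negative times are sent to 0, so that the flow is continuous on a whole product
space. *)
Lemma flow_continuous : continuous (fun p : N * R => F p.1 (Num.max 0 p.2)).
Proof.
move=> [x0 q]; apply/cvgrPdist_lt => e e0 /=.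
have q0 : 0 <= Num.max 0 q by rewrite le_max lexx.
have [B nB [d d0 hd]] := flow_near x0 q0 e0.
exists (B, ball q d); first by split=> //; exact: nbhsx_ballx.
move=> [x t] /= [Bx]; rewrite -ball_normE/= => qt; rewrite distrC; apply: hd => //.
  apply: le_lt_trans qt; rewrite distrC.
  rewrite /Num.max; case: (ltrP 0 t) => h1; case: (ltrP 0 q) => h2 //;
    rewrite ?subrr ?normr0// ?subr0 ?sub0r ?normrN.
    by rewrite distrC [leRHS]ger0_norm; [rewrite gtr0_norm//; lra|lra].
  by rewrite distrC [leRHS]ler0_norm; [rewrite gtr0_norm//; lra|lra].
by rewrite le_max lexx.
Qed.

Lemma flow_locally_injective (x0 : N) (t0 : R) : 0 <= t0 ->
  exists2 O, nbhs x0 O & exists2 d, 0 < d & forall x y s t, O x -> O y ->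
    `|s - t0| < d -> `|t - t0| < d -> 0 <= s -> 0 <= t -> F x s = F y t ->
    x = y /\ s = t.
Proof.
have [c ac [u cu <-{x0}]] := surface_cover x0; move=> t00.
have [kap [m [M [[m0 _] hm _ [_ [B' nB' kinj]] strict]]]] := flow_strict ac cu t00.
have m2 : 0 < m / 2 by rewrite divr_gt0.
have [B nB [d d0 hd]] := strict _ m2.
exists (B' `&` B); first exact: filterI.
exists d => // x y s t [B'x Bx] [B'y By] sd td s0 t0' E.
have := hd x y s t Bx By sd td s0 t0'; rewrite E subrr sub0r normrN => h.
have {}h := le_trans (hm _ _) h.
move: h; set z := (_, _) => h.
have z0 : z = 0.
  apply/eqP; rewrite -normr_le0; have := normr_ge0 z.
  by move: h; set w := `|z|; nra.
case: z0 => /eqP; rewrite subr_eq0 => /eqP kxy /eqP; rewrite subr_eq0 => /eqP ->.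
by split=> //; exact: kinj.
Qed.

Hypothesis F_inj : forall t, 0 <= t -> injective (F ^~ t).

(** Near a pair of equal points this is local injectivity, and near a pair of distinct
points it is continuity, as F is injective at time t0.  Compactness of N x N makes
the time interval uniform. *)
Lemma flow_uniformly_injective (t0 : R) : 0 <= t0 ->
  exists2 d, 0 < d & forall x y s t,
    `|s - t0| < d -> `|t - t0| < d -> 0 <= s -> 0 <= t -> F x s = F y t ->
    x = y /\ s = t.
Proof.
move=> t00.
pose P (i : R * R) (p : N * N) := 0 <= i.1 -> 0 <= i.2 -> F p.1 i.1 = F p.2 i.2 ->
  p.1 = p.2 /\ i.1 = i.2.
have cNN : compact [set: N * N].
  by rewrite -setXTT; apply: compact_setX; exact: surface_compact.
have /compact_near_coveringP/(_ _ (nbhs (t0, t0)) P _) near_cov := cNN.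
have : \forall i \near (t0, t0), [set: N * N] `<=` P i.
  apply: near_cov => -[x y] _.
  have [xy|xy] := pselect (x = y).
    rewrite -{y}xy; have [B nB [d d0 hd]] := flow_locally_injective x t00.
    exists (B `*` B, ball t0 d `*` ball t0 d).
      split=> /=; first by exists (B, B).
      by exists (ball t0 d, ball t0 d) => //; split; exact: nbhsx_ballx.
    move=> [[x' y'] [s t]] /= [[Bx By] [sd td]] s0 t0' E; apply: hd => //.
      by move: sd; rewrite -ball_normE/= distrC.
    by move: td; rewrite -ball_normE/= distrC.
  have ne : 0 < `|F x t0 - F y t0| / 2.
    rewrite divr_gt0// normr_gt0 subr_eq0; apply/eqP => E; apply: xy.
    exact: (F_inj t00) E.
  have [B1 nB1 [d1 d10 h1]] := flow_near x t00 ne.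
  have [B2 nB2 [d2 d20 h2]] := flow_near y t00 ne.
  exists (B1 `*` B2, ball t0 d1 `*` ball t0 d2).
    split=> /=; first by exists (B1, B2).
    exists (ball t0 d1, ball t0 d2) => //.
    by split; [exact: nbhsx_ballx d10|exact: nbhsx_ballx d20].
  move=> [[x' y'] [s t]] /= [[Bx By] [sd td]] s0 t0' E; exfalso.
  have g1 : `|F x' s - F x t0| < `|F x t0 - F y t0| / 2.
    by apply: h1 => //; move: sd; rewrite -ball_normE/= distrC.
  have g2 : `|F y' t - F y t0| < `|F x t0 - F y t0| / 2.
    by apply: h2 => //; move: td; rewrite -ball_normE/= distrC.
  have := ltrD g1 g2; rewrite -splitr -E ltNge => /negP; apply.
  by rewrite [X in _ <= X + _]distrC; apply: le_trans (ler_normD _ _); rewrite subrKA.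
move=> /nbhs_ballP[d /= d0 hd]; exists d => // x y s t sd td s0 t0' E.
have := hd (s, t) _ (x, y) I s0 t0' E; apply.
by split; rewrite -ball_normE/= distrC.
Qed.

(** * The distance from a point to the moving surface *)

Lemma flow_time_diff (c : set E2 * (E2 -> N)) (u : E2) (t e : R) :
  atlas c -> c.1 u -> 0 <= t -> 0 < e ->
  exists2 d, 0 < d & forall s, `|s - t| < d -> 0 <= s ->
    `|F (c.2 u) s - F (c.2 u) t - ((s - t) * speed c u t) *: nu (c.2 u) t| <=
      e * `|s - t|.
Proof.
move=> ac cu t0 e0.
have [kap [m [M [_ _ _ _ strict]]]] := flow_strict ac cu t0.
have [B nB [d d0 hd]] := strict e e0; exists d => // s sd s0.
have Bx := nbhs_singleton nB.
have := hd (c.2 u) (c.2 u) s t Bx Bx sd; rewrite subrr normr0 => /(_ d0 s0 t0).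
rewrite subrr linear0 add0r prod_normE /= normr0 max_r//.
Qed.

(** The squared distance to p has time derivative 2 k b, where k is the normal speed
and b the inner product of the normal with the position relative to p. *)
Lemma sqdist_time (c : set E2 * (E2 -> N)) (u : E2) (t e : R) (p : E3) :
  atlas c -> c.1 u -> 0 <= t -> 0 < e ->
  let b := dot (F (c.2 u) t - p) (nu (c.2 u) t) in
  exists2 d, 0 < d & forall s, `|s - t| < d -> 0 <= s ->
    `|sqdist p (F (c.2 u) s) - sqdist p (F (c.2 u) t)
      - (s - t) * (2 * speed c u t * b)| <= e * `|s - t|.
Proof.
move=> ac cu t0 e0 b; set n := nu (c.2 u) t in b *; set k := speed _ _ _.
set A := F (c.2 u) t - p in b *.
pose a := 6 * `|A| + 1; have a0 : 0 < a by rewrite ltr_wpDl// mulr_ge0.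
pose e1 := Num.min 1 (e / (2 * a)).
have e10 : 0 < e1 by rewrite lt_min ltr01 divr_gt0// mulr_gt0.
have e11 : e1 <= 1 by rewrite ge_min lexx.
have e12 : e1 * (2 * a) <= e by rewrite -ler_pdivlMr ?mulr_gt0// ge_min lexx orbT.
have [d d0 hd] := flow_time_diff ac cu t0 e10.
pose C := `|k| * `|n| + 1; have C0 : 0 < C by rewrite ltr_wpDl// mulr_ge0.
(* C bounds the displacement per unit of time; d2 makes its square negligible. *)
pose d2 := e / (6 * C ^+ 2).
have d20 : 0 < d2 by rewrite divr_gt0// mulr_gt0// exprn_gt0.
exists (Num.min d d2); first by rewrite lt_min d0 d20.
move=> s; rewrite lt_min => /andP[sd sd2] s0.
have := hd s sd s0; rewrite -/k -/n.
set w := F (c.2 u) s - F (c.2 u) t => hr.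
have -> : sqdist p (F (c.2 u) s) = sqdist p (F (c.2 u) t) + 2 * dot A w + dot w w.
  have -> : sqdist p (F (c.2 u) s) = dot (A + w) (A + w).
    by rewrite /sqdist /A /w [_ - p + _]addrC subrKA.
  exact: dot_sqrD.
pose r := w - ((s - t) * k) *: n; rewrite -/r in hr.
have wE : w = ((s - t) * k) *: n + r by rewrite /r addrC subrK.
have wn : `|w| <= C * `|s - t|.
  rewrite wE; apply: le_trans (ler_normD _ _) _.
  rewrite /C [X in _ <= X]mulrDl mul1r lerD//.
    by rewrite normrZ normrM le_eqVlt; apply/orP; left; apply/eqP; ring.
  by apply: le_trans hr _; rewrite ler_piMl.
have -> : sqdist p (F (c.2 u) t) + 2 * dot A w + dot w w - sqdist p (F (c.2 u) t)
    - (s - t) * (2 * k * b) = 2 * dot A r + dot w w.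
  by rewrite {1}wE dotDr dotZr /b; ring.
apply: le_trans (ler_normD _ _) _.
have h1 : `|2 * dot A r| <= e / 2 * `|s - t|.
  rewrite normrM ger0_norm//; have := dot_norm_le A r.
  have hA := normr_ge0 A; have hs := normr_ge0 (s - t).
  have : 3 * `|A| * `|r| <= 3 * `|A| * (e1 * `|s - t|) by rewrite ler_wpM2l// mulr_ge0.
  move=> g1 g2.
  have g3 : 6 * `|A| * e1 <= e / 2.
    move: e12; rewrite /a; move: (`|A|) hA => A' hA' e12.
    by rewrite ler_pdivlMr//; nra.
  have : 6 * `|A| * e1 * `|s - t| <= e / 2 * `|s - t| by rewrite ler_wpM2r.
  by move: g1 g2; set x := `|dot A r|; set y := `|A|; set z := `|r|; lra.
have h2 : `|dot w w| <= e / 2 * `|s - t|.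
  apply: le_trans (dot_norm_le w w) _.
  have hw := normr_ge0 w; have hs := normr_ge0 (s - t).
  have g1 : `|w| * `|w| <= (C * `|s - t|) * (C * `|s - t|) by rewrite ler_pM.
  have g2 : `|s - t| * (6 * C ^+ 2) <= e.
    by rewrite -ler_pdivlMr ?mulr_gt0 ?exprn_gt0// ltW.
  have g3 : `|s - t| * (6 * C ^+ 2) * `|s - t| <= e * `|s - t| by rewrite ler_wpM2r.
  by rewrite -mulrA; move: g1 g3; set W := `|w| * `|w|; lra.
by apply: le_trans (lerD h1 h2) _; rewrite -mulrDl -splitr.
Qed.

(** At a nearest point the position relative to p is normal, equal to b n; the second
derivative test says that the first form minus b times the second form is
nonnegative, and its trace is 2 - b H. *)
Lemma nearest_point (c : set E2 * (E2 -> N)) (u : E2) (t : R) (p : E3) :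
  atlas c -> c.1 u -> 0 <= t ->
  (forall y, sqdist p (F (c.2 u) t) <= sqdist p (F y t)) ->
  let b := dot (F (c.2 u) t - p) (nu (c.2 u) t) in
  F (c.2 u) t - p = b *: nu (c.2 u) t /\ b <= 2 * speed c u t.
Proof.
move=> ac cu t0 hmin b.
have [oc sX [dX injX] un k0] := flow_frame ac cu t0.
set X := fun v => F (c.2 v) t in sX dX injX un.
set n := nu (c.2 u) t in b un *.
have near_min : \forall v \near u, sqdist p (X u) <= sqdist p (X v).
  by apply/nbhs_ballP; exists 1 => //= v _; exact: hmin.
have crit a : dot (X u - p) ('d X u a) = 0 /\
    0 <= dot ('d X u a) ('d X u a) + dot (X u - p) ('D_a ('D_a X) u).
  exact: (sqdist_critical oc sX cu near_min a).
have E : X u - p = b *: n.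
  have [a Ea] := tangent_normal_decomposition (X u - p) injX un.
  have V0 : dot ('d X u a) ('d X u a) = 0.
    have aux (w V : E3) (r : R) : w = V + r *: n -> dot n V = 0 -> dot w V = dot V V.
      by move=> -> e; rewrite dotDl dotZl e mulr0 addr0.
    by have [h _] := crit a; rewrite -(aux _ _ _ Ea (un.2 a)).
  by rewrite {1}Ea (dot_eq0 V0) add0r.
split; first exact: E.
have posI := first_form_posdef dX injX.
have uI := posdef_unitmx posI.
have := @trace_quad_ge0 _ (first_form X u) (first_form X u - b *: second_form X u n)
  (sym_first_form X u) posI.
have Q a : 0 <= quad (first_form X u - b *: second_form X u n) a.
  have [_] := crit a; rewrite E dotZl -quad_first_form// quadB.
  by rewrite quadZ (quad_second_form a n oc sX cu) mulrN opprK.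
move=> /(_ Q); rewrite mulmxBr mulVmx// -scalemxAr mxtraceD mxtrace1.
rewrite -scaleNr mxtraceZ mulNr subr_ge0.
have -> : \tr (invmx (first_form X u) *m second_form X u n) = (speed c u t)^-1.
  by rewrite /speed invrK.
by rewrite ler_pdivrMr// mulrC.
Qed.

Lemma slab_nearest_point (x1 : N) (a b : R) (p : E3) :
  0 <= a <= b ->
  exists x s, a <= s <= b /\ forall y r, a <= r <= b ->
    sqdist p (F x s) <= sqdist p (F y r).
Proof.
move=> /andP[a0 ab].
pose K : set (N * R) := [set: N] `*` [set` `[a, b]].
have cK : compact K.
  by apply: compact_setX; [exact: surface_compact|exact: segment_compact].
have K0 : K !=set0 by exists (x1, a); split=> //=; rewrite in_itv/= lexx ab.
pose f (q : N * R) := sqdist p (F q.1 (Num.max 0 q.2)).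
have cf : continuous f.
  have cg q : {for q, continuous (fun q : N * R => F q.1 (Num.max 0 q.2) - p)}.
    by apply: cvgD; [exact: flow_continuous|exact: cvg_cst].
  by move=> q; exact: (continuous_dot (cg q) (cg q)).
have [[x s]] := compact_EVT_min K0 cK (continuous_subspaceT cf).
rewrite inE => -[_ /=]; rewrite in_itv/= => sab hmin.
exists x, s; split=> // y r rab.
have := hmin (y, r); rewrite /f/= !max_r ?(le_trans a0)//; last first.
- by case/andP: sab.
- by case/andP: rab.
by apply; rewrite inE; split=> //=; rewrite in_itv.
Qed.

(** By [nearest_point] the position relative to p is normal, and by the vanishing of
the time derivative its normal component is zero. *)
Lemma slab_interior_minimum (a b s : R) (x : N) (p : E3) :
  0 <= a -> a < s < b ->
  (forall y r, a <= r <= b -> sqdist p (F x s) <= sqdist p (F y r)) ->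
  F x s = p.
Proof.
move=> a0 /andP[sa sb] hmin.
have s0 : 0 <= s by rewrite (le_trans a0)// ltW.
have [c ac [u cu xE]] := surface_cover x; subst x.
have sab : a <= s <= b by rewrite !ltW.
have [E _] := nearest_point (p := p) ac cu s0 (fun y => hmin y s sab).
have [_ _ _ _ k0] := flow_frame ac cu s0.
move: E; set n := nu _ _; set B := dot _ n => E.
suff B0 : B = 0 by apply/eqP; rewrite -subr_eq0 E B0 scale0r.
apply/eqP; apply: contraT => Bn.
have kB : 0 < `|speed c u s * B| by rewrite normr_gt0 mulf_neq0// gt_eqF.
have [d d0 hd] := sqdist_time p ac cu s0 kB.
pose h := Num.min d (Num.min (s - a) (b - s)) / 2.
have mn0 : 0 < Num.min d (Num.min (s - a) (b - s)).
  by rewrite !lt_min d0 !subr_gt0 sa sb.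
have h0 : 0 < h by rewrite divr_gt0.
have : h < Num.min d (Num.min (s - a) (b - s)) by rewrite ltr_pdivrMr// ltr_pMr// ltr1n.
rewrite !lt_min => /andP[hd1 /andP[ha hb]].
have step (z : R) : `|z| = h -> 0 <= z * (2 * (speed c u s * B)) +
    `|speed c u s * B| * h.
  move=> zh; have zb : `|z| <= h by rewrite zh.
  move: zb; rewrite ler_norml => /andP[z1 z2].
  have := hd (s + z); rewrite [s + z - s]addrAC subrr add0r zh.
  move=> /(_ hd1); have sz0 : 0 <= s + z by lra.
  move=> /(_ sz0); rewrite -/n -/B => h1.
  have h2 : 0 <= sqdist p (F (c.2 u) (s + z)) - sqdist p (F (c.2 u) s).
    by rewrite subr_ge0; apply: hmin; lra.
  have := le_trans (ler_norm _) h1; move: h2.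
  by set q := _ - sqdist _ _; rewrite -[2 * _ * B]mulrA; lra.
have := step h (gtr0_norm h0); have := step (- h).
rewrite normrN gtr0_norm// => /(_ erefl).
move: kB; set y := speed c u s * B.
case: (ltrP 0 y) => y0; [rewrite (gtr0_norm y0)|rewrite (ler0_norm y0)]; nra.
Qed.

(** * Cones at the moving surface *)

Lemma flow_preimage_near (x0 : N) (t : R) (B : set N) : 0 <= t -> nbhs x0 B ->
  exists2 e, 0 < e & forall z, `|F z t - F x0 t| < e -> B z.
Proof.
move=> t0 nB.
pose P (e : R) (z : N) := `|F z t - F x0 t| < e -> B z.
have cN := @surface_compact _ N.
have /compact_near_coveringP/(_ _ (0 : R)^'+ P _) near_cov := cN.
have : \forall e \near (0 : R)^'+, [set: N] `<=` P e.
  apply: near_cov => z _.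
  have [zx|zx] := pselect (F z t = F x0 t).
    have -> : z = x0 by exact: (F_inj t0).
    exists (B, setT); first by split=> //; exact: filterT.
    by move=> [y e] /= [By _] _.
  have e0 : 0 < `|F z t - F x0 t| / 2.
    by rewrite divr_gt0// normr_gt0 subr_eq0; apply/eqP.
  have [B' nB' [d d0 hd]] := flow_near z t0 e0.
  exists (B', [set e : R | e < `|F z t - F x0 t| / 2]).
    by split=> //=; exact: nbhs_right_lt.
  move=> [y e] /= [B'y le] h; exfalso.
  have h1 : `|F y t - F z t| < `|F z t - F x0 t| / 2.
    by apply: hd => //; rewrite subrr normr0.
  have := ltrD h1 (lt_trans h le); rewrite -splitr ltNge => /negP; apply.
  by rewrite [X in _ <= X + _]distrC; apply: le_trans (ler_normD _ _); rewrite subrKA.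
move=> h; have [e [e0 he]] : exists e : R, 0 < e /\ [set: N] `<=` P e.
  near (0 : R)^'+ => e; exists e; split; near: e => //.
  exact: nbhs_right_gt.
by exists e => // z hz; exact: he.
Unshelve. all: by end_near. Qed.

(** A point z with F z t = F y t + w is close to y by [flow_preimage_near], hence w is
an increment of F ^~ t, whose normal component is small compared with its norm.
This is not the case for the vectors of the cone. *)
Lemma cone_avoids_surface (c : set E2 * (E2 -> N)) (u : E2) (t M : R) :
  atlas c -> c.1 u -> 0 <= t -> 0 < M ->
  exists2 B, nbhs (c.2 u) B & exists2 d, 0 < d & forall y w z, B y ->
    cone (nu (c.2 u) t) M d w -> F y t + w <> F z t.
Proof.
move=> ac cu t0 M0.
have [_ _ _ [n1 nX] k0] := flow_frame ac cu t0.
have [kap [m [L [[m0 _] hm _ _ strict]]]] := flow_strict ac cu t0.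
set n := nu (c.2 u) t in n1 nX hm strict *.
(* The first bound makes the increment of kap at most 2 |w| / m, the second one
   then its normal error at most half of |w| / M. *)
pose e := Num.min (m / 2) (m / (12 * M)).
have e0 : 0 < e by rewrite lt_min !divr_gt0// mulr_gt0.
have e1 : e * 2 <= m by rewrite -ler_pdivlMr// ge_min lexx.
have e2 : e * (12 * M) <= m by rewrite -ler_pdivlMr ?mulr_gt0// ge_min lexx orbT.
have [B nB [d d0 hd]] := strict e e0.
have [r r0 hr] := flow_preimage_near t0 nB.
have r2 : 0 < r / 2 by rewrite divr_gt0.
have [B' nB' [d' d'0 hd']] := flow_near (c.2 u) t0 r2.
exists (B `&` B'); first exact: filterI.
exists (r / (2 * M)); first by rewrite divr_gt0// mulr_gt0.
move=> y w z [By B'y] [/andP[w0 wd] wM] E.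
have wr : `|w| < r / 2.
  apply: le_lt_trans wM _; move: wd; rewrite ltr_pdivlMr ?mulr_gt0//.
  by rewrite ltr_pdivlMr//; lra.
have Bz : B z.
  apply: hr; rewrite -E addrAC [r]splitr; apply: le_lt_trans (ler_normD _ _) _.
  by apply: ltrD => //; apply: hd' => //; rewrite subrr normr0.
have tt : `|t - t| < d by rewrite subrr normr0.
have := hd z y t t Bz By tt tt t0 t0; rewrite subrr mul0r scale0r addr0.
rewrite -E [F y t + w - _]addrAC subrr add0r.
have := hm (kap z - kap y) 0; rewrite mul0r scale0r addr0.
have nD := nX (kap z - kap y).
set D := 'd _ _ _ in nD *; rewrite prod_normE/= normr0 max_l// => g1 g2.
set a := `|kap z - kap y| in g1 g2; have a0 : 0 <= a := normr_ge0 _.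
have g3 : `|D| <= `|w| + e * a.
  have -> : D = w - (w - D) by rewrite subKr.
  by apply: le_trans (ler_normB _ _) _; rewrite lerD2l.
have g4 : m * a <= 2 * `|w| by move: (normr_ge0 w); nra.
have g5 : dot n w <= 3 * (e * a).
  have -> : dot n w = dot n (w - D) by rewrite dotBr nD subr0.
  apply: le_trans (ler_norm _) _; apply: le_trans (unit_dot_le _ n1) _.
  by rewrite ler_wpM2l.
have g6 : e * (12 * M) * a <= m * a by rewrite ler_wpM2r.
have g7 : 12 * M * (e * a) <= 2 * (M * dot n w) by lra.
have g8 : 12 * (e * a) <= 2 * dot n w by rewrite -(ler_pM2l M0); lra.
lra.
Qed.

(** Small displacements in time are close to multiples of the normal vector, so any
aperture above 1 would do. *)
Lemma cone_contains_future (c : set E2 * (E2 -> N)) (u : E2) (t d' : R) :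
  atlas c -> c.1 u -> 0 <= t -> 0 < d' ->
  exists2 B, nbhs (c.2 u) B & exists2 d, 0 < d & forall y s, B y -> 0 < s < d ->
    cone (nu (c.2 u) t) 2 d' (F y (t + s) - F y t).
Proof.
move=> ac cu t0 d'0.
have [_ _ _ [n1 nX] k0] := flow_frame ac cu t0.
have [kap [m [L [_ _ _ _ strict]]]] := flow_strict ac cu t0.
set n := nu (c.2 u) t in n1 nX strict *; set k := speed _ _ _ in k0 strict.
have k8 : 0 < k / 8 by rewrite divr_gt0.
have [B nB [d d0 hd]] := strict _ k8.
exists B => //; exists (Num.min d (d' / (2 * k))).
  by rewrite lt_min d0 divr_gt0// mulr_gt0.
move=> y s By /andP[s0]; rewrite lt_min => /andP[sd sd'].
have ts0 : 0 <= t + s by rewrite addr_ge0// ltW.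
have := hd y y (t + s) t By By; rewrite [t + s - t]addrAC subrr add0r gtr0_norm//.
rewrite subrr normr0 => /(_ sd d0 ts0 t0).
rewrite linear0 add0r prod_normE/= normr0 gtr0_norm// (max_r (ltW s0)).
move: (F y (t + s) - F y t) => w h.
have E1 : dot n w = s * k + dot n (w - (s * k) *: n).
  by rewrite dotBr dotZr n1 mulr1 addrC subrK.
have h1 := le_trans (unit_dot_le (w - (s * k) *: n) n1) (ler_wpM2l (ler0n _ 3) h).
have h2 : `|w| <= s * k + k / 8 * s.
  rewrite -[w](subrK ((s * k) *: n)) addrC; apply: le_trans (ler_normD _ _) _.
  rewrite lerD// normrZ gtr0_norm ?mulr_gt0// ler_piMr ?unit_norm_le1//.
  by rewrite mulr_ge0// ltW.
have sk : 0 < s * k by rewrite mulr_gt0.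
move: sd'; rewrite ltr_pdivlMr ?mulr_gt0// => sd'.
move: h1; rewrite ler_norml => /andP[h3 h4].
by split; rewrite E1; lra.
Qed.

(** * The region swept out by the flow is open *)

Variable E0 : set E3.
Hypothesis E0_open : open E0.
Hypothesis F_start : range (F ^~ 0) = frontier E0.
Hypothesis nu_outward : forall x, points_outward E0 (F x 0) (nu x 0).

Definition swept (t : R) : set E3 :=
  E0 `|` [set q | exists x s, 0 <= s < t /\ q = F x s].

Lemma swept0 : swept 0 = E0.
Proof.
apply/seteqP; split=> [q [//|[x [s [/andP[s0 sn] _]]]]|q]; last by left.
by move: sn; rewrite ltNge s0.
Qed.

Lemma sub_swept s t : s <= t -> swept s `<=` swept t.
Proof.
move=> st q [E0q|[x [r [/andP[r0 rs] ->]]]]; first by left.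
by right; exists x, r; rewrite r0 (lt_le_trans rs).
Qed.

Lemma closure_start q : closure E0 q -> E0 q \/ exists x, q = F x 0.
Proof.
move=> cq; have [Eq|nEq] := pselect (E0 q); first by left.
right; have : frontier E0 q by split=> // /interior_subset.
by rewrite -F_start => -[x _ <-]; exists x.
Qed.

(** A point outside the closure of E0 sees its nearest boundary point from outside:
otherwise the inward normal at that point would lead into the ball around p that
the boundary avoids, and this ball is outside E0. *)
Lemma outward_normal_component (c : set E2 * (E2 -> N)) (u : E2) (p : E3) :
  atlas c -> c.1 u -> ~ closure E0 p ->
  (forall y, sqdist p (F (c.2 u) 0) <= sqdist p (F y 0)) ->
  dot (F (c.2 u) 0 - p) (nu (c.2 u) 0) < 0.
Proof.
move=> ac cu out hmin.
have [E _] := nearest_point ac cu (lexx 0) hmin.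
have [_ _ _ [n1 _] _] := flow_frame ac cu (lexx 0).
move: E; set b := dot _ _; set n := nu _ _ in n1 * => E.
rewrite ltNge; apply/negP; rewrite le_eqVlt => /orP[/eqP b0|b0].
  apply: out; have -> : p = F (c.2 u) 0.
    by apply/eqP; rewrite eq_sym -subr_eq0 E -b0 scale0r.
  have : frontier E0 (F (c.2 u) 0) by rewrite -F_start; exists (c.2 u).
  by case.
have [s [sb [s0 Es]]] : exists s, s < b /\ 0 < s /\ E0 (F (c.2 u) 0 - s *: n).
  near (0 : R)^'+ => s; exists s; split; first by near: s; exact: nbhs_right_lt.
  split; first by near: s; exact: nbhs_right_gt.
  suff [] : E0 (F (c.2 u) 0 - s *: n) /\ ~ closure E0 (F (c.2 u) 0 + s *: n) by [].
  by near: s; exact: nu_outward.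
have WS : frontier E0 `<=` range (F ^~ 0) by rewrite F_start.
have sq (r : R) : sqdist p (F (c.2 u) 0 - r *: n) = (b - r) ^+ 2.
  by rewrite /sqdist addrAC E -scalerBl dotZl dotZr n1 mulr1 expr2.
apply: (near_outside WS out (q := F (c.2 u) 0 - s *: n)) (subset_closure Es).
move=> _ [y _ <-]; apply: lt_le_trans (hmin y).
rewrite sq -[F (c.2 u) 0]subr0 -(scale0r n) sq subr0.
by rewrite ltr_pXn2r ?nnegrE//; lra.
Unshelve. all: by end_near. Qed.

Lemma time_derivative_neg (c : set E2 * (E2 -> N)) (u : E2) (t : R) (p : E3) :
  atlas c -> c.1 u -> 0 <= t -> dot (F (c.2 u) t - p) (nu (c.2 u) t) < 0 ->
  exists2 d, 0 < d & forall s, 0 < s < d ->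
    sqdist p (F (c.2 u) (t + s)) < sqdist p (F (c.2 u) t).
Proof.
move=> ac cu t0 b0.
have [_ _ _ _ k0] := flow_frame ac cu t0.
set b := dot _ _ in b0; set k := speed _ _ _ in k0.
have kb : 0 < - (k * b) by rewrite oppr_gt0 pmulr_rlt0.
have [d d0 hd] := sqdist_time p ac cu t0 kb.
exists d => // s /andP[s0 sd].
have := hd (t + s); rewrite [t + s - t]addrAC subrr add0r gtr0_norm// => /(_ sd).
have ts : 0 <= t + s by rewrite addr_ge0// ltW.
move=> /(_ ts) h; have := le_trans (ler_norm _) h.
rewrite -/b -/k -[2 * k * b]mulrA.
have := mulr_gt0 kb s0; set x := sqdist _ _; set y := sqdist _ _; lra.
Qed.

Lemma far_from_surface (t : R) (q : E3) : 0 <= t -> (forall y, F y t <> q) ->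
  \forall p \near q, forall y, sqdist p q < sqdist p (F y t).
Proof.
move=> t0 ne.
have cN := @surface_compact _ N.
pose P (p : E3) (y : N) := sqdist p q < sqdist p (F y t).
have /compact_near_coveringP/(_ _ (nbhs q) P _) near_cov := cN.
suff : \forall p \near q, [set: N] `<=` P p.
  by apply: filterS; move=> p hp y; exact: hp.
apply: near_cov => y _.
have qy : 0 < sqdist q (F y t).
  rewrite lt_neqAle sqdist_ge0 andbT eq_sym; apply/eqP => /sqdist_eq0.
  exact: ne.
have c1 : {for (y, q),
    continuous (fun z : N * E3 => sqdist z.2 (F z.1 t) - sqdist z.2 q)}.
  have F1 : {for (y, q), continuous (fun z : N * E3 => F z.1 t)}.
    apply/cvgrPdist_lt => e e0; have [B nB [d d0 hd]] := flow_near y t0 e0.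
    exists (B, setT); first by split=> //; exact: filterT.
    move=> [z p] /= [Bz _]; rewrite distrC; apply: hd => //.
    by rewrite subrr normr0.
  have F2 : {for (y, q), continuous (fun z : N * E3 => F z.1 t - z.2)}.
    by apply: cvgB; [exact: F1|exact: cvg_snd].
  have F3 : {for (y, q), continuous (fun z : N * E3 => q - z.2)}.
    by apply: cvgB; [exact: cvg_cst|exact: cvg_snd].
  exact: (cvgB (continuous_dot F2 F2) (continuous_dot F3 F3)).
have /cvgrPdist_lt/(_ _ qy) := c1.
rewrite /= [sqdist q q]/sqdist subrr dot0l subr0.
apply: filterS => -[z p] /=; rewrite /P => h.
have := le_lt_trans (ler_norm _) h; rewrite opprB addrCA; lra.
Qed.

(** Let p be close to F x s.  A minimum of the distance from p over N x [a, b] is not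
attained at the end times, because the surfaces at these times do not contain
F x s ([flow_uniformly_injective], [far_from_surface]); so it is zero.  If s = 0
then a = 0, and the minimum is not attained at time 0 for a different reason: for p
outside the closure of E0, the distance from p to its nearest boundary point
decreases initially. *)
Lemma open_swept t : 0 <= t -> open (swept t).
Proof.
move=> t0; rewrite openE => q [E0q|[x [s [/andP[s0 st] ->{q}]]]].
  have : nbhs q E0 by exact: open_nbhs_nbhs.
  by apply: filterS; move=> z; left.
have [d d0 hd] := flow_uniformly_injective s0.
have off r : 0 <= r -> r != s -> `|r - s| < d -> forall y, F y r <> F x s.
  move=> r0 rs rd y E; have ss : `|s - s| < d by rewrite subrr normr0.
  by have [_ /eqP] := hd _ _ _ _ rd ss r0 s0 E; apply/negP.
pose h := Num.min d (t - s) / 2.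
have mn0 : 0 < Num.min d (t - s) by rewrite lt_min d0 subr_gt0.
have h0 : 0 < h by rewrite divr_gt0.
have : h < Num.min d (t - s) by rewrite ltr_pdivrMr// ltr_pMr// ltr1n.
rewrite lt_min => /andP[hd1 ht].
have farb : \forall p \near F x s, forall y, sqdist p (F x s) < sqdist p (F y (s + h)).
  apply: far_from_surface; first by rewrite addr_ge0// ltW.
  apply: off; first by rewrite addr_ge0// ltW.
    by rewrite gt_eqF// ltrDl.
  by rewrite addrAC subrr add0r gtr0_norm.
move: s0; rewrite le_eqVlt => /orP[/eqP s0|s0].
  subst s; apply: filterS farb => p farp.
  have [/closure_start[E0p|[y ->]]|out] := pselect (closure E0 p); first by left.
    by right; exists y, 0; rewrite lexx st.
  rewrite add0r in farp.
  have [|y [r [/andP[r0 rh] hmin]]] := slab_nearest_point x (b := h) p (a := 0).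
    by rewrite lexx ltW.
  have rh' : r < h.
    rewrite lt_neqAle rh andbT; apply/eqP => E; subst r.
    by have := farp y; rewrite ltNge hmin// lexx ltW.
  right; exists y, r; rewrite r0 (lt_trans rh')//; last by rewrite subr0 in ht.
  split=> //; move: r0; rewrite le_eqVlt => /orP[/eqP r0|r0]; last first.
    by apply/esym/(slab_interior_minimum (lexx 0) _ hmin); rewrite r0 rh'.
  subst r; exfalso.
  have [c ac [u cu yE]] := surface_cover y; subst y.
  have b0 : dot (F (c.2 u) 0 - p) (nu (c.2 u) 0) < 0.
    by apply: outward_normal_component => // y; apply: hmin; rewrite lexx ltW.
  have [d1 d10 hd2] := time_derivative_neg ac cu (lexx 0) b0.
  pose z := Num.min d1 h / 2.
  have mz : 0 < Num.min d1 h by rewrite lt_min d10 h0.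
  have z0 : 0 < z by rewrite divr_gt0.
  have : z < Num.min d1 h by rewrite ltr_pdivrMr// ltr_pMr// ltr1n.
  rewrite lt_min => /andP[zd zh].
  have := hd2 z; rewrite z0 zd add0r => /(_ isT); rewrite ltNge hmin//.
  by rewrite !ltW.
pose g := Num.min d s / 2.
have mg : 0 < Num.min d s by rewrite lt_min d0 s0.
have g0 : 0 < g by rewrite divr_gt0.
have : g < Num.min d s by rewrite ltr_pdivrMr// ltr_pMr// ltr1n.
rewrite lt_min => /andP[gd gs].
have fara : \forall p \near F x s, forall y, sqdist p (F x s) < sqdist p (F y (s - g)).
  apply: far_from_surface; first by rewrite subr_ge0 ltW.
  apply: off; first by rewrite subr_ge0 ltW.
    by rewrite lt_eqF// gtrBl.
  by rewrite addrAC subrr add0r normrN gtr0_norm.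
apply: filterS (filterI farb fara) => p [fb fa].
have [|y [r [/andP[ra rb] hmin]]] := slab_nearest_point x (b := s + h) p (a := s - g).
  by apply/andP; split; lra.
have sab : s - g <= s <= s + h by apply/andP; split; lra.
have rb' : r < s + h.
  rewrite lt_neqAle rb andbT; apply/eqP => E; subst r.
  by have := fb y; rewrite ltNge hmin.
have ra' : s - g < r.
  rewrite lt_neqAle ra andbT; apply/eqP => E; subst r.
  by have := fa y; rewrite ltNge hmin.
right; exists y, r; split; first by apply/andP; split; lra.
apply/esym/(slab_interior_minimum _ _ hmin); last by rewrite ra' rb'.
by rewrite subr_ge0 ltW.
Qed.

Lemma unit_nu x t : 0 <= t -> dot (nu x t) (nu x t) = 1.
Proof.
move=> t0; have [c ac [u cu <-]] := surface_cover x.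
by have [_ _ _ []] := flow_frame ac cu t0.
Qed.

(** * The surfaces are disjoint *)

Hypothesis nu_start : forall x e, 0 < e -> \forall y \near x, `|nu y 0 - nu x 0| < e.

(** Near a given point, the small cones around the normal are disjoint from the
boundary of E0 and contain both the points F y s for small s > 0 and points on the
outward normal at F y 0; the latter are outside E0. *)
Lemma leaves_start_immediately :
  exists2 d, 0 < d & forall x s, 0 < s < d -> ~ closure E0 (F x s).
Proof.
pose P (s : R) (x : N) := ~ closure E0 (F x s).
have cN := @surface_compact _ N.
have /compact_near_coveringP/(_ _ (0 : R)^'+ P _) near_cov := cN.
have WS : frontier E0 `<=` range (F ^~ 0) by rewrite F_start.
have : \forall s \near (0 : R)^'+, [set: N] `<=` P s.
  apply: near_cov => x _; have [c ac [u cu xE]] := surface_cover x; subst x.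
  have [B nB [d d0 hd]] := cone_avoids_surface ac cu (lexx 0) (ltr0n _ 2).
  have [B' nB' [d2 d20 hd2]] := cone_contains_future ac cu (lexx 0) d0.
  have e6 : 0 < 1 / 6 :> R by [].
  exists ((B `&` B') `&` [set y | `|nu y 0 - nu (c.2 u) 0| < 1 / 6],
      [set s | 0 < s] `&` [set s : R | s < d2]).
    split=> /=; first by apply: filterI; [exact: filterI|exact: nu_start].
    by apply: filterI; [exact: nbhs_right_gt|exact: nbhs_right_lt].
  move=> [y s] /= [[[By B'y] ny] [s0 sd]].
  set n := nu (c.2 u) 0 in hd hd2 ny.
  have n1 : dot n n = 1 by exact: unit_nu.
  have w1 := hd2 y s B'y; rewrite s0 sd add0r in w1; have {}w1 := w1 isT.
  have avoid w : cone n 2 d w -> ~ range (F ^~ 0) (F y 0 + w).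
    by move=> cw [z _ /esym]; exact: hd.
  have [r [r0 [rd out]]] : exists r,
      0 < r /\ r < d / 3 /\ ~ closure E0 (F y 0 + r *: nu y 0).
    near (0 : R)^'+ => r; exists r; split; first by near: r; exact: nbhs_right_gt.
    split; first by near: r; apply: nbhs_right_lt; rewrite divr_gt0.
    suff [] : E0 (F y 0 - r *: nu y 0) /\ ~ closure E0 (F y 0 + r *: nu y 0) by [].
    by near: r; exact: nu_outward.
  have w0 : cone n 2 d (r *: nu y 0).
    have ny1 : `|nu y 0| <= 1 by apply: unit_norm_le1; exact: unit_nu.
    have h1 : 1 / 2 <= dot n (nu y 0).
      have -> : dot n (nu y 0) = 1 + dot n (nu y 0 - n).
        by rewrite dotBr n1 addrC subrK.
      have := unit_dot_le (nu y 0 - n) n1; rewrite ler_norml => /andP[h _].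
      by lra.
    have h2 : dot n (nu y 0) <= 3.
      apply: le_trans (ler_norm _) _; apply: le_trans (unit_dot_le _ n1) _.
      by rewrite ler_piMr.
    split; rewrite dotZr.
      rewrite mulr_gt0 ?(lt_le_trans _ h1)//=.
      apply: (@le_lt_trans _ _ (r * 3)); first by rewrite ler_pM2l.
      by rewrite -ltr_pdivlMr.
    rewrite normrZ gtr0_norm// mulrCA ler_pM2l//; lra.
  have := cone_out_closure WS avoid w0 out w1.
  by rewrite /P addrC subrK.
move=> /nbhs_ballP[d /= d0 hd]; exists d => // x s /andP[s0 sd].
apply: (hd s) => //.
by rewrite -ball_normE/= sub0r normrN gtr0_norm.
Unshelve. all: by end_near. Qed.

Definition hull (t : R) : set E3 :=
  E0 `|` [set q | exists x s, 0 <= s <= t /\ q = F x s].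

Lemma closed_hull t : 0 <= t -> closed (hull t).
Proof.
move=> t0; pose K : set (N * R) := [set: N] `*` [set` `[0, t]].
have -> : hull t = closure E0 `|` (fun p : N * R => F p.1 (Num.max 0 p.2)) @` K.
  apply/seteqP; split=> [q [E0q|[x [s [/andP[s0 st] ->]]]]|q [/closure_start[]|]].
  - by left; exact: subset_closure.
  - right; exists (x, s); last by rewrite /= max_r.
    by split=> //=; rewrite in_itv/= s0.
  - by left.
  - by move=> [x ->]; right; exists x, 0; rewrite lexx t0.
  - move=> [[x s] [_ /=]]; rewrite in_itv/= => /andP[s0 st] <-.
    by right; exists x, s; rewrite s0 st max_r.
apply: closedU; first exact: closed_closure.
apply: compact_closed; first exact: norm_hausdorff.
apply: continuous_compact; first exact: continuous_subspaceT flow_continuous.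
by apply: compact_setX; [exact: surface_compact|exact: segment_compact].
Qed.

Lemma swept_sub_hull t : swept t `<=` hull t.
Proof.
move=> q [|[x [s [/andP[s0 st] ->]]]]; first by left.
by right; exists x, s; rewrite s0 ltW.
Qed.

Lemma hull_sub_swept s t : 0 <= s -> s < t -> hull s `<=` swept t.
Proof.
move=> s0 st q [|[x [r [/andP[r0 rs] ->]]]]; first by left.
by right; exists x, r; rewrite r0 (le_lt_trans rs).
Qed.

Lemma hull_split t q : hull t q -> swept t q \/ exists x, q = F x t.
Proof.
move=> [|[x [s [/andP[s0 st] ->]]]]; first by left; left.
move: st; rewrite le_eqVlt => /orP[/eqP ->|st]; first by right; exists x.
by left; right; exists x, s; rewrite s0 st.
Qed.

Lemma flow_leaves_closed (K : set E3) (t : R) : closed K -> 0 <= t ->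
  (forall x, ~ K (F x t)) ->
  exists2 d, 0 < d & forall x s, 0 <= s -> `|s - t| < d -> ~ K (F x s).
Proof.
move=> cK t0 out; pose P (s : R) (x : N) := 0 <= s -> ~ K (F x s).
have cN := @surface_compact _ N.
have /compact_near_coveringP/(_ _ (nbhs t) P _) near_cov := cN.
have : \forall s \near t, [set: N] `<=` P s.
  apply: near_cov => x _.
  have /nbhs_ballP[e /= e0 he] : nbhs (F x t) (~` K).
    by apply: open_nbhs_nbhs; split; [exact: closed_openC|exact: out].
  have [B nB [d d0 hd]] := flow_near x t0 e0.
  exists (B, ball t d); first by split=> //; exact: nbhsx_ballx.
  move=> [y s] /= [By]; rewrite -ball_normE/= distrC => st s0.
  by apply: he; rewrite -ball_normE/= distrC; exact: hd.
move=> /nbhs_ballP[d /= d0 hd]; exists d => // x s s0 st.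
by apply: (hd s) => //; rewrite -ball_normE/= distrC.
Qed.

(** At a time shortly after t the surface cannot meet the surfaces of times close to t,
by uniform injectivity; the earlier ones form, with E0, a closed set which N_t
avoids.  At t = 0 the closure of E0 meets N_0, and [leaves_start_immediately] takes
the place of this argument. *)
(** Continuous induction: the infimum of the bad times is not bad by
[swept_disjoint_left], and not a limit of later bad times by
[swept_disjoint_right]. *)
Lemma swept_disjoint_right t : 0 <= t -> (forall x, ~ swept t (F x t)) ->
  exists2 d, 0 < d & forall x s, t < s < t + d -> ~ swept s (F x s).
Proof.
move=> t0 dis; have [d d0 hd] := flow_uniformly_injective t0.
have inj x y s r : t - d < r -> r < s -> s < t + d -> 0 <= r -> F x s <> F y r.
  move=> tr rs sd r0 E; have [||||_ /eqP] := hd _ _ _ _ _ _ _ _ E => //.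
  - by rewrite ltr_norml; apply/andP; split; lra.
  - by rewrite ltr_norml; apply/andP; split; lra.
  - lra.
  - by rewrite gt_eqF.
move: (t0); rewrite le_eqVlt => /orP[/eqP tE|t0'].
  subst t; have [d' d'0 hd'] := leaves_start_immediately.
  exists (Num.min d d'); first by rewrite lt_min d0 d'0.
  move=> x s /andP[s0]; rewrite add0r lt_min => /andP[sd sd'].
  case=> [E0s|[y [r [/andP[r0 rs] E]]]].
    by apply: (hd' x s); [rewrite s0 sd'|exact: subset_closure].
  by apply: (inj x y s r) E => //; lra.
pose r0 := Num.max 0 (t - d / 2).
have r00 : 0 <= r0 by rewrite le_max lexx.
have rt : r0 < t by rewrite gt_max t0'; lra.
have out x : ~ hull r0 (F x t) by move=> /(hull_sub_swept r00 rt); exact: dis.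
have [d' d'0 hd'] := flow_leaves_closed (closed_hull r00) t0 out.
exists (Num.min d d'); first by rewrite lt_min d0 d'0.
move=> x s /andP[ts]; rewrite -ltrBlDl lt_min => /andP[sd sd'].
have s0 : 0 <= s by rewrite ltW// (le_lt_trans t0).
have := hd' x s s0; rewrite ger0_norm ?subr_ge0 1?ltW// => /(_ sd') nh.
case=> [E0s|[y [r [/andP[r1 rs] E]]]]; first by apply: nh; left.
have [rr|rr] := leP r r0; first by apply: nh; right; exists y, r; rewrite r1 rr.
apply: (inj x y s r) E => //; last by lra.
by move: rr; rewrite gt_max => /andP[_]; lra.
Qed.

(** A point of N_t in the swept region already lies in an open region swept before t,
which nearby earlier surfaces then meet too. *)
Lemma swept_disjoint_left t : 0 < t ->
  (forall s, 0 <= s < t -> forall x, ~ swept s (F x s)) -> forall x, ~ swept t (F x t).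
Proof.
move=> t0 dis x sx.
have [s [s0 [st ss]]] : exists s, 0 <= s /\ s < t /\ swept s (F x t).
  case: sx => [E0x|[y [r [/andP[r0 rt] E]]]]; first by exists 0; do ?split=> //; left.
  exists ((r + t) / 2); split; first by lra.
  split; first by lra.
  by right; exists y, r; split=> //; apply/andP; split=> //; lra.
have /nbhs_ballP[e /= e0 he] : nbhs (F x t) (swept s).
  by apply: open_nbhs_nbhs; split=> //; exact: (open_swept).
have [B nB [d d0 hd]] := flow_near x (ltW t0) e0.
pose m := Num.min d (t - s); have m0 : 0 < m by rewrite lt_min d0 subr_gt0.
have md : m <= d by rewrite ge_min lexx.
have ms : m <= t - s by rewrite ge_min lexx orbT.
apply: (dis (t - m / 2) _ x); first by apply/andP; split; lra.
apply: (@sub_swept s); first by lra.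
apply: he; rewrite -ball_normE/= distrC; apply: hd; [exact: nbhs_singleton| |lra].
by rewrite addrAC subrr add0r normrN gtr0_norm; lra.
Qed.

Lemma swept_disjoint t x : 0 <= t -> ~ swept t (F x t).
Proof.
move=> t0 sx.
pose B := [set s : R | 0 <= s /\ exists y, swept s (F y s)].
have Bt : B t by split=> //; exists x.
have lbB : lbound B 0 by move=> s [].
have hB : has_inf B by split; [exists t|exists 0].
have i0 : 0 <= inf B by apply: lb_le_inf => //; exists t.
have before s : 0 <= s < inf B -> forall y, ~ swept s (F y s).
  move=> /andP[s0 si] y sy; have Bs : B s by split=> //; exists y.
  by have := ge_inf hB.2 Bs; rewrite leNgt si.
have ati y : ~ swept (inf B) (F y (inf B)).
  move: i0; rewrite le_eqVlt => /orP[/eqP <-|i0].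
    rewrite swept0 => Ey; have : frontier E0 (F y 0) by rewrite -F_start; exists y.
    by move=> [_]; apply; have := E0_open; rewrite openE => /(_ _ Ey).
  exact: swept_disjoint_left.
have [d d0 hd] := swept_disjoint_right i0 ati.
have [b [b0 [y sb]] bd] := inf_adherent d0 hB.
have ib : inf B <= b by apply: ge_inf; [exact: hB.2|split=> //; exists y].
move: ib; rewrite le_eqVlt => /orP[/eqP E|ib]; first by apply: (ati y); rewrite E.
by apply: (hd y b) => //; rewrite ib bd.
Qed.

Lemma closure_swept t : 0 <= t -> closure (swept t) `<=` hull t.
Proof.
move=> t0; rewrite [hull t](closure_id _).1; last exact: closed_hull.
by apply: closure_subset; exact: swept_sub_hull.
Qed.

Lemma frontier_swept t : 0 <= t -> frontier (swept t) `<=` range (F ^~ t).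
Proof.
move=> t0 q [/(closure_swept t0)/hull_split[sq|[x ->]] nq]; last by exists x.
by case: nq; have := open_swept t0; rewrite openE => /(_ q sq).
Qed.

Lemma outside_hull s t x : 0 <= s -> s < t -> ~ hull s (F x t).
Proof.
move=> s0 st /(hull_sub_swept s0 st); apply: swept_disjoint.
by rewrite (le_trans s0)// ltW.
Qed.

(** The cone avoids the frontier of the swept region and contains points that the flow
reaches only after time t. *)
Lemma cone_outside_hull (c : set E2 * (E2 -> N)) (u : E2) (t M : R) :
  atlas c -> c.1 u -> 0 <= t -> 2 <= M ->
  exists2 B, nbhs (c.2 u) B & exists2 d, 0 < d & forall y w, B y ->
    cone (nu (c.2 u) t) M d w -> ~ hull t (F y t + w).
Proof.
move=> ac cu t0 M2; have M0 : 0 < M by lra.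
have [B nB [d d0 hd]] := cone_avoids_surface ac cu t0 M0.
have [B' nB' [d2 d20 hd2]] := cone_contains_future ac cu t0 d0.
exists (B `&` B'); first exact: filterI.
exists d => // y w [By B'y] cw.
have avoid v : cone (nu (c.2 u) t) M d v -> ~ range (F ^~ t) (F y t + v).
  by move=> cv [z _ /esym]; exact: hd.
pose s := d2 / 2; have s0 : 0 < s by rewrite divr_gt0.
have sd : s < d2 by rewrite ltr_pdivrMr// ltr_pMr// ltr1n.
have c0 : cone (nu (c.2 u) t) M d (F y (t + s) - F y t).
  have [|a b] := hd2 y s B'y; first by rewrite s0 sd.
  split=> //; apply: le_trans b _; case/andP: a => a _.
  by rewrite ler_pM2r.
have ts : t < t + s by rewrite ltrDl.
have out : ~ closure (swept t) (F y t + (F y (t + s) - F y t)).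
  by rewrite addrC subrK => /(closure_swept t0); exact: outside_hull.
have := cone_out_closure (frontier_swept t0) avoid c0 out cw.
move=> nc /hull_split[sw|[z E]]; first by apply: nc; exact: subset_closure.
by apply: (avoid w cw); exists z.
Qed.

(** * Expanding spheres as barriers *)

(** If the outward normal pointed towards p, the surface would at once move into the
ball around p that N_t avoids, and this ball lies in the swept region. *)
Lemma nearest_point_outward (c : set E2 * (E2 -> N)) (u : E2) (t : R) (p : E3) :
  atlas c -> c.1 u -> 0 <= t -> E0 p ->
  (forall y, sqdist p (F (c.2 u) t) <= sqdist p (F y t)) ->
  0 < dot (F (c.2 u) t - p) (nu (c.2 u) t).
Proof.
move=> ac cu t0 E0p hmin.
have [E _] := nearest_point ac cu t0 hmin.
have sp : swept t p by left.
have dis := swept_disjoint.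
rewrite ltNge; apply/negP; rewrite le_eqVlt => /orP[/eqP b0|b0].
  apply: (dis t (c.2 u) t0); have -> : F (c.2 u) t = p; last by [].
  by apply/eqP; rewrite -subr_eq0 E b0 scale0r.
have [d d0 hd] := time_derivative_neg ac cu t0 b0.
pose s := d / 2; have s0 : 0 < s by rewrite divr_gt0.
have sd : s < d by rewrite ltr_pdivrMr// ltr_pMr// ltr1n.
have ts : 0 <= t + s by rewrite addr_ge0// ltW.
apply: (dis (t + s) (c.2 u) ts); apply: (@sub_swept t); first by rewrite lerDl ltW.
apply: near_inside (frontier_swept t0) sp _.
move=> _ [y _ <-]; apply: lt_le_trans (hmin y).
by apply: hd; rewrite s0.
Qed.

(** The squared distance rho^2 from p to N_t satisfies (rho^2)' >= rho^2, so it grows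
faster than the linear function m (1 + t / 2).  Differentiating the minimum is
avoided by minimising the quotient over N x [0, T]: at a minimum at a positive
time, the left derivative contradicts this inequality. *)
Lemma expanding_barrier (x1 : N) (p : E3) : E0 p ->
  exists2 m, 0 < m & forall t y, 0 <= t -> m * (1 + t / 2) <= sqdist p (F y t).
Proof.
move=> E0p.
have [|x [r [/andP[r0 r1] hmin]]] := slab_nearest_point (a := 0) (b := 0) x1 p.
  by rewrite lexx.
have {r0 r1} rE : r = 0 by apply/eqP; rewrite eq_le r0 r1.
subst r.
have dis := swept_disjoint.
have pos y t : 0 <= t -> 0 < sqdist p (F y t).
  move=> t0; rewrite lt_neqAle sqdist_ge0 andbT eq_sym; apply/eqP => /sqdist_eq0 E.
  by apply: (dis t y t0); rewrite E; left.
exists (sqdist p (F x 0)); first exact: pos.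
move=> T z T0; have phi (s : R) : 0 <= s -> 0 < 1 + s / 2 by move=> s0; lra.
(* Sending negative times to 0 extends the quotient continuously to N x R. *)
pose K : set (N * R) := [set: N] `*` [set` `[0, T]].
have cK : compact K.
  by apply: compact_setX; [exact: surface_compact|exact: segment_compact].
have K0 : K !=set0 by exists (x1, 0); split=> //=; rewrite in_itv/= lexx T0.
pose f (q : N * R) := sqdist p (F q.1 (Num.max 0 q.2)) / (1 + Num.max 0 q.2 / 2).
have cmax : continuous (fun q : N * R => Num.max 0 q.2).
  by move=> q; apply: continuous_max; [exact: cvg_cst|exact: cvg_snd].
have cf : continuous f.
  move=> q; apply: cvgM.
    have cg : {for q, continuous (fun q : N * R => F q.1 (Num.max 0 q.2) - p)}.
      by apply: cvgB; [exact: flow_continuous|exact: cvg_cst].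
    exact: (continuous_dot cg cg).
  apply: cvgV; first by rewrite gt_eqF// phi// le_max lexx.
  by apply: cvgD; [exact: cvg_cst|apply: cvgMl; exact: cmax].
have [[y t]] := compact_EVT_min K0 cK (continuous_subspaceT cf).
rewrite inE => -[_ /=]; rewrite in_itv/= => /andP[t0 tT] fmin.
have fE w s : 0 <= s -> f (w, s) = sqdist p (F w s) / (1 + s / 2).
  by move=> s0; rewrite /f /= max_r.
have {}fmin w s : 0 <= s <= T -> f (y, t) <= f (w, s).
  by move=> sT; apply: fmin; rewrite inE; split=> //=; rewrite in_itv.
rewrite -ler_pdivlMr ?phi// -fE//.
apply: le_trans (fmin z T _); last by rewrite T0 lexx.
move: t0; rewrite le_eqVlt => /orP[/eqP t0|t0].
  subst t; rewrite fE// mul0r addr0 divr1.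
  by apply: hmin; rewrite lexx.
exfalso; set mu := f (y, t) in fmin.
have tt0 := ltW t0.
have sqE : sqdist p (F y t) = mu * (1 + t / 2).
  by rewrite /mu fE// divfK// gt_eqF// phi.
have mu0 : 0 < mu by rewrite /mu fE// divr_gt0 ?phi// pos.
have bound w s : 0 <= s <= T -> mu * (1 + s / 2) <= sqdist p (F w s).
  by move=> sT; case/andP: (sT) => s0 _; rewrite -ler_pdivlMr ?phi// -fE// fmin.
have [c ac [u cu yE]] := surface_cover y; subst y.
have hm w : sqdist p (F (c.2 u) t) <= sqdist p (F w t).
  by rewrite sqE bound// tt0.
have [E b2] := nearest_point ac cu tt0 hm.
have b0 := nearest_point_outward ac cu tt0 E0p hm.
have [_ _ _ [n1 _] k0] := flow_frame ac cu tt0.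
have mu4 : 0 < mu / 4 by rewrite divr_gt0.
have [d d0 hd] := sqdist_time p ac cu tt0 mu4.
move: E b2 b0 k0 hd.
set b := dot _ _; set k := speed _ _ _ => E b2 b0 k0 hd.
have sqb : sqdist p (F (c.2 u) t) = b ^+ 2.
  by rewrite /sqdist E dotZl dotZr n1 mulr1 expr2.
pose s := Num.min d t / 2.
have md : 0 < Num.min d t by rewrite lt_min d0 t0.
have s0 : 0 < s by rewrite divr_gt0.
have : s < Num.min d t by rewrite ltr_pdivrMr// ltr_pMr// ltr1n.
rewrite lt_min => /andP[sd st].
have ts : 0 <= t - s by rewrite subr_ge0 ltW.
have := hd (t - s); rewrite addrAC subrr add0r normrN gtr0_norm// => /(_ sd ts) h.
have h1 := le_trans (ler_norm _) h.
have h2 : mu * (1 + (t - s) / 2) <= sqdist p (F (c.2 u) (t - s)).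
  by apply: bound; rewrite ts /=; lra.
rewrite sqE in h1.
have h3 : mu <= 2 * k * b.
  apply: (@le_trans _ _ (b ^+ 2)); last by rewrite expr2 ler_pM2r.
  by rewrite -sqb sqE ler_pMr//; lra.
have h4 : s * mu <= s * (2 * k * b) by rewrite ler_pM2l.
have h5 : 0 < s * mu by rewrite mulr_gt0.
move: h1 h2 h4; set Z := sqdist _ _; set Y := 2 * k * b; lra.
Qed.

Lemma swept_exhausts (x1 : N) (p : E3) : E0 p -> forall C, exists2 T, 0 <= T &
  forall q, sqdist p q <= C -> swept T q.
Proof.
move=> E0p C; have [m m0 hm] := expanding_barrier x1 E0p.
pose T := 2 * (`|C| / m); have T0 : 0 <= T by rewrite mulr_ge0// divr_ge0// ltW.
exists T => // q qC.
apply: near_inside (frontier_swept T0) (_ : swept T p) _.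
  by left.
move=> _ [y _ <-]; apply: le_lt_trans qC _; apply: lt_le_trans (hm T y T0).
have -> : m * (1 + T / 2) = m + `|C| by rewrite /T; field; rewrite gt_eqF.
by rewrite (le_lt_trans (ler_norm C))// ltrDr.
Qed.

(** * The touching principle *)

(** A curve on f that starts at the point of contact and leaves the surface on its
outer side enters a cone outside the hull, which is impossible.  To first order
this gives tangency.  To second order, take a curve on the surface with the same
velocity: the normal component of the second derivative of f does not exceed that
of the surface.  Hence the mean curvature of f is at least that of the surface. *)
Lemma no_interior_touching (U : set E2) (f : E2 -> E3) (u : E2) (x : N) (t : R) :
  open U -> immersion_on U f -> U u ->
  (forall n, unit_normal f u n -> mean_curvature f u n = 0) ->
  0 <= t -> (forall v, U v -> hull t (f v)) -> f u <> F x t.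
Proof.
move=> oU [sf injf] Uu minf t0 inside fux.
have [c ac [y cy xE]] := surface_cover x; subst x.
have [oc sX [dX injX] [n1 nX] k0] := flow_frame ac cy t0.
pose X := fun v => F (c.2 v) t.
set n := nu (c.2 y) t in n1 nX.
have df v : U v -> differentiable f v by case: (sf 1%N) => + _; exact.
have never (w : R -> E3) (b : E2) (M : R) : 2 <= M ->
    (forall d, 0 < d -> \forall s \near (0 : R)^'+, cone n M d (w s)) ->
    (\forall s \near (0 : R)^'+, hull t (X (y + s *: b) + w s)) -> False.
  move=> M2 hcone hhull.
  have [B nB [d d0 hd]] := cone_outside_hull ac cy t0 M2.
  have cline : (fun s : R => y + s *: b) @ (0 : R) --> y.
    rewrite -[X in _ --> X]addr0 -[X in _ + X](scale0r b).
    by apply: cvgD; [exact: cvg_cst|exact: scalel_continuous].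
  have cc : {for y, continuous c.2} by have [_ _ + _] := surface_chart ac; exact.
  have nBs : \forall s \near (0 : R)^'+, B (c.2 (y + s *: b)).
    have cB : nbhs y (c.2 @^-1` B) by exact: cc.
    have h : \forall s \near (0 : R), B (c.2 (y + s *: b)) by exact: (cline _ cB).
    exact: cvg_within h.
  near (0 : R)^'+ => s.
  have cs : cone n M d (w s) by near: s; exact: hcone.
  have Bs : B (c.2 (y + s *: b)) by near: s.
  by apply: hd Bs cs _; near: s.
have line a : \forall s \near (0 : R)^'+, U (u + s *: a).
  have cline : (fun s : R => u + s *: a) @ (0 : R) --> u.
    rewrite -[X in _ --> X]addr0 -[X in _ + X](scale0r a).
    by apply: cvgD; [exact: cvg_cst|exact: scalel_continuous].
  have nU : nbhs u U by exact: open_nbhs_nbhs.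
  have h : \forall s \near (0 : R), U (u + s *: a) by exact: (cline _ nU).
  exact: cvg_within h.
have tangent_le a : dot n ('D_a f u) <= 0.
  rewrite leNgt; apply/negP => pos.
  have [M M2 hM] := @higher_order_in_cone _ (fun s => f (u + s *: a) - f u)
    ('D_a f u) n 0 n1 pos (fun e => @expansion_order1 _ U f u a e oU sf Uu).
  apply: (never _ 0 M M2 hM).
  apply: filterS (line a) => s Us.
  by rewrite scaler0 addr0 /X -fux addrC subrK; exact: inside.
have DE a : 'D_a f u = 'd f u a by apply: deriveE; exact: df.
have tangent a : dot n ('d f u a) = 0.
  apply/eqP; rewrite eq_le -[X in X <= 0](congr1 (dot n) (DE a)) tangent_le /=.
  have := tangent_le (- a); rewrite (DE (- a)) linearN dotNr oppr_le0.
  exact.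
have unf : unit_normal f u n by [].
have immX : immersion_on c.1 X by case: flow => _ /(_ t t0 c ac).
have := @mean_curvature_comparison _ U c.1 f X u y n oU (conj sf injf) Uu oc immX cy
  unf (conj n1 nX).
rewrite (minf n unf) => H.
have : (speed c y t)^-1 <= 0.
  rewrite /speed invrK; apply: H => a b Eab.
  rewrite leNgt; apply/negP => pos.
  have DXE : 'D_b X y = 'd X y b by exact: deriveE.
  have Dab : 'D_a f u = 'D_b X y by rewrite DE DXE.
  have pos2 : 0 < dot n (2^-1 *: ('D_a ('D_a f) u - 'D_b ('D_b X) y)).
    by rewrite dotZr mulr_gt0 ?invr_gt0// dotBr subr_gt0.
  have [M M2 hM] := @higher_order_in_cone _
    (fun s => f (u + s *: a) - X (y + s *: b)) _ n 1 n1 pos2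
    (fun e => @expansion_order2 _ U c.1 f X u y a b e oU sf Uu oc sX cy fux Dab).
  apply: (never _ b M M2 hM).
  apply: filterS (line a) => s Us.
  by rewrite addrC subrK; exact: inside.
by rewrite leNgt invr_gt0 k0.
Unshelve. all: by end_near. Qed.

End Flow.

(** * Minimal disks stay inside *)

Theorem corollary10p4 (R : realType) (E0 : set 'rV[R]_3)
    (E0_open : open E0) (E0_nonempty : E0 !=set0) (E0_connected : connected E0)
    (E0_bounded : bounded_set E0)
    (N0_smooth : smooth_hypersurface (frontier E0))
    (N0_connected : connected (frontier E0))
    (N0_mean_convex : mean_convex_boundary E0)
    (N : closedSurface R) (F0 : N -> 'rV[R]_3)
    (F0_embedding : embedding F0) (F0_image : range F0 = frontier E0)
    (Tmax : \bar R) (F : N -> R -> 'rV[R]_3)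
    (F_maximal : maximal_IMCF E0 F0 Tmax F)
    (Tmax_infinite : Tmax = +oo%E)
    (F_embedded : forall t : R, 0 <= t -> embedding (F ^~ t))
    (gamma : set 'rV[R]_3) (gamma_jordan : jordan_curve gamma)
    (gamma_sub : gamma `<=` closure E0)
    (D : set 'rV[R]_3) (D_disk : stable_minimal_disk D gamma) :
  D `<=` E0.
Proof.
subst Tmax.
case: F_maximal => -[_ FF0 smF immF [nu [nuc nuout eqF]]] _.
have timeE : time_interval (+oo%E : \bar R) = [set t : R | 0 <= t].
  by apply/seteqP; split=> t /=; [case|move=> t0; split=> //; exact: ltry].
rewrite timeE in smF nuc.
have flow : flow_equation F nu.
  split=> [//|t t0|c u t ac cu t0]; first by apply: immF; rewrite timeE.
  by have := eqF c u t ac cu; rewrite timeE; exact.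
have F_inj t : 0 <= t -> injective (F ^~ t) by move=> /F_embedded[].
have F_start : range (F ^~ 0) = frontier E0.
  by rewrite -F0_image; apply/seteqP; split=> _ [x _ <-]; exists x.
have nu_outward x : points_outward E0 (F x 0) (nu x 0) by rewrite FF0.
have nu_start x e : 0 < e -> \forall y \near x, `|nu y 0 - nu x 0| < e.
  move=> e0; move/subspace_continuousP: nuc => /(_ (x, 0)) /=.
  have A0 : ([set: N] `*` [set t : R | 0 <= t]) (x, 0) by split=> //=.
  move=> /(_ A0) /cvgrPdist_lt/(_ e e0); rewrite near_withinE => -[[B C] /= [nB nC] BC].
  apply: filterS nB => y By; rewrite distrC; apply: (BC (y, 0)) => //.
  by split=> //=; exact: nbhs_singleton nC.
case: D_disk => f [cf immf [_ fcirc] [minf _] ->].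
move=> _ [u Du <-]; apply: contrapT => nE0.
have [p E0p] := E0_nonempty.
(* If N were empty, E0 would have no frontier and would be the whole space. *)
have [x1 _] : exists x : N, True.
  apply: contrapT => noN; apply: nE0.
  apply: (@near_inside _ E0 (range (F ^~ 0)) p); rewrite ?F_start//.
  by rewrite -F_start => z [x _ _]; case: noN; exists x.
have disk_sub : @unit_disk R `<=` closed_disk 1.
  by move=> v; rewrite /closed_disk /= expr1n; exact: ltW.
have cK : compact (f @` closed_disk 1).
  by apply: continuous_compact => //; exact: compact_closed_disk.
have [C hC] : exists C, forall v, closed_disk 1 v -> sqdist p (f v) <= C.
  have cs : {within closed_disk 1, continuous (fun v => sqdist p (f v))}.
    move=> v.
    have cg : {for v, continuous (fun v : subspace (closed_disk 1) => f v - p)}.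
      by apply: cvgB; [exact: cf|exact: cvg_cst].
    exact: (continuous_dot cg cg).
  have [w _ hw] :=
    compact_EVT_max (ex_intro _ u (disk_sub _ Du)) compact_closed_disk cs.
  by exists (sqdist p (f w)) => v v1; apply: hw; rewrite inE.
have [T T0 hT] := swept_exhausts flow F_inj E0_open F_start nu_outward nu_start x1 E0p C.
have dis := swept_disjoint flow F_inj E0_open F_start nu_outward nu_start.
(* S is the set of times at which the surface meets the closed disk. *)
pose S := [set s : R | 0 <= s /\ exists x v, closed_disk 1 v /\ F x s = f v].
have [s1 [y1 [Ss1 fu]]] : exists s y, S s /\ f u = F y s.
  have [|[y [s [/andP[s0 _] E]]]] := hT _ (hC _ (disk_sub _ Du)); first by [].
  by exists s, y; split=> //; split=> //; exists y, u; split=> //; exact: disk_sub.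
have ubS : ubound S T.
  move=> s [s0 [x [v [v1 E]]]]; rewrite leNgt; apply/negP => Ts.
  apply: (dis s x s0); rewrite E; apply: (@sub_swept _ _ _ _ T); first exact: ltW.
  exact: hT (hC _ v1).
have hS : has_sup S by split; [exists s1|exists T].
pose t := sup S.
have Sle s : S s -> s <= t by move=> Ss; apply: sup_upper_bound.
have t0 : 0 <= t by apply: le_trans (Sle _ Ss1); case: Ss1.
have inside v : closed_disk 1 v -> hull F E0 t (f v).
  move=> v1; have [|[y [s [/andP[s0 _] E]]]] := hT _ (hC _ v1); first by left.
  right; exists y, s; split=> //; rewrite s0 /=; apply: Sle.
  by split=> //; exists y, v; rewrite E.
(* The last time of contact is attained, as N_t would otherwise be disjoint from
   the compact disk together with all nearby surfaces. *)
have [x [v [v1 E]]] : exists x v, closed_disk 1 v /\ F x t = f v.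
  apply: contrapT => none.
  have closedK : closed (f @` closed_disk 1).
    by apply: compact_closed => //; exact: norm_hausdorff.
  have out x : ~ (f @` closed_disk 1) (F x t).
    by move=> [v v1 E]; apply: none; exists x, v.
  have [d d0 hd] := flow_leaves_closed flow closedK t0 out.
  have [s Ss ds] := sup_adherent d0 hS.
  have st := Sle _ Ss; case: Ss => s0 [x [v [v1 E]]].
  apply: (hd x s s0); last by exists v.
  by rewrite distrC ger0_norm ?subr_ge0//; rewrite -/t in ds; lra.
have touch w z : unit_disk w -> f w = F z t -> False.
  move=> Dw; apply: (no_interior_touching flow F_inj E0_open F_start nu_outward nu_start
    open_unit_disk immf Dw (fun n => minf w n Dw) t0).
  by move=> v' /disk_sub; exact: inside.
move: (t0); rewrite le_eqVlt => /orP[/eqP tE|tpos].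
  apply: (touch u y1 Du); rewrite fu -tE; congr (F y1 _).
  by apply/eqP; rewrite eq_le; have := Sle _ Ss1; rewrite -tE => ->; case: Ss1.
case: (closed_disk1P v1) => [Dv|Cv]; first exact: (touch v x Dv).
have gv : gamma (f v) by rewrite -fcirc; exists v.
apply: (dis t x t0); rewrite E.
have [E0v|[z ->]] := closure_start F_start (gamma_sub _ gv); first by left.
by right; exists z, 0; rewrite lexx tpos.
Qed.
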